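(* Let $0<p\le q$ and $0<r\le s$. Suppose $p\le 1$, $r\le 1$, and $f: S_{p,q}\to S_{r,s}$ is a surjective $\alpha$-Hölder map, where $0<\alpha\le 1$. Then $$\alpha \le \frac{p+q+r+s-pr+qs}{(2+s-r)(p+q)}.$$
   Context: For $0<p\le q$, the elliptical polynomial spiral is $S_{p,q} = \{ t^{-p}\cos t + i\, t^{-q}\sin t : 1 < t < \infty\} \subset \mathbb{C} \cong \mathbb{R}^2$. A function $f:X\to Y$ between subsets of the plane is $\alpha$-Hölder ($0<\alpha\le 1$) if there exists $c>0$ such that $|f(x)-f(y)|\le c|x-y|^\alpha$ for all $x,y\in X$. *)

(* Defs.v *)
From Stdlib Require Export Reals.
From Coquelicot Require Export Coquelicot.
Open Scope R_scope.

(* Points of the plane are Coquelicot's complex numbers [C = R * R], with the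
   Euclidean modulus [Cmod]; subsets of the plane are predicates on [C]. *)

Definition elliptical_spiral (p q : R) (z : C) : Prop :=
  exists t : R,
    1 < t /\ z = (Rpower t (- p) * cos t, Rpower t (- q) * sin t).

(* A function X -> Y is represented by a total [f : C -> C] whose values
   outside X are irrelevant. *)
Definition maps_to (f : C -> C) (X Y : C -> Prop) : Prop :=
  forall x : C, X x -> Y (f x).

Definition surjective_onto (f : C -> C) (X Y : C -> Prop) : Prop :=
  forall y : C, Y y -> exists x : C, X x /\ f x = y.

(* [Rpower 0 alpha] is not 0 in the library, but it is only reached when
   x = y, where the left-hand side vanishes and the inequality is trivially
   true, as it is with the convention 0^alpha = 0. *)
Definition Holder_on (alpha : R) (f : C -> C) (X : C -> Prop) : Prop :=
  exists c : R, 0 < c /\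
    forall x y : C, X x -> X y ->
      Cmod (f x - f y)%C <= c * Rpower (Cmod (x - y)%C) alpha.

(* Main.v *)
Require Import Defs.
From Stdlib Require Import Reals Ranalysis5 Lra Lia ZArith List Classical ClassicalEpsilon.
From Coquelicot Require Import Coquelicot.
Open Scope R_scope.

(** Write [X t] and [Y u] for the points of [S_(p,q)] and [S_(r,s)], and
    [f (X t) = Y (g t)] with [g] continuous.

    Counting: about [M ^ (2 + s - r)] points of the turns of [S_(r,s)] between
    the parameters [M] and a multiple of [M] are [M ^ (- 1 - s)]-separated. If
    these turns are covered by the image of an arc of [S_(p,q)] of length at
    most [M ^ e], then cutting that arc into pieces of diameter
    [M ^ (- (1 + s) / alpha)] gives [2 + s - r <= e + (1 + s) / alpha].

    If [g] is bounded near infinity, then a bounded arc covers all inner turns.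
    Otherwise [f] tends to [0] along the spiral, and continuity of [g] together
    with the shape of the two spirals shows that the arc [t <= T] covers, where
    [T ^ (- p * alpha)] is comparable to the long axis [M ^ - r] of the turns,
    or alternatively (by a winding argument) where [T ^ (- q * alpha)] is
    comparable to the short axis [M ^ - s]. The arc has length [T ^ (1 - p)],
    so [e = k * (1 - p) / alpha] for both [k = r / p] and [k = s / q]; the
    smaller of these two ratios is at most their mediant
    [(r + s) / (p + q)], which is the claim. *)

(** * Real powers and real functions *)

Lemma Rpower_pos (x a : R) : 0 < Rpower x a.
Proof. apply exp_pos. Qed.

Lemma Rpower_1_l (a : R) : Rpower 1 a = 1.
Proof. unfold Rpower; rewrite ln_1, Rmult_0_r; apply exp_0. Qed.

Lemma Rpower_lt_l (x y a : R) : 0 < a -> 0 < x < y -> Rpower x a < Rpower y a.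
Proof.
intros Ha [Hx Hxy]; apply exp_increasing, Rmult_lt_compat_l; [easy | now apply ln_increasing].
Qed.

Lemma Rpower_neg_le_l (x y a : R) :
  0 <= a -> 0 < x <= y -> Rpower y (- a) <= Rpower x (- a).
Proof.
intros Ha Hxy; rewrite 2!Rpower_Ropp.
apply Rinv_le_contravar; [apply Rpower_pos | now apply Rle_Rpower_l].
Qed.

Lemma Rpower_neg_le_1 (x a : R) : 0 <= a -> 1 <= x -> Rpower x (- a) <= 1.
Proof.
intros Ha Hx; rewrite <- (Rpower_1_l (- a)); apply Rpower_neg_le_l; lra.
Qed.

Lemma Rpower_ge_1 (x a : R) : 0 <= a -> 1 <= x -> 1 <= Rpower x a.
Proof. intros Ha Hx; rewrite <- (Rpower_1_l a); apply Rle_Rpower_l; lra. Qed.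

Lemma is_derive_Rpower (x a : R) :
  0 < x -> is_derive (fun t => Rpower t a) x (a * Rpower x (a - 1)).
Proof.
intros Hx; apply is_derive_Reals; now apply derivable_pt_lim_power.
Qed.

Lemma continuity_pt_Rpower (x a : R) : 0 < x -> continuity_pt (fun t => Rpower t a) x.
Proof.
intros Hx; apply derivable_continuous_pt; exists (a * Rpower x (a - 1)).
now apply derivable_pt_lim_power.
Qed.

Lemma Rpower_large (a b : R) : 0 < a -> exists x0, 1 < x0 /\ forall x, x0 <= x -> b < Rpower x a.
Proof.
intros Ha.
set (c := Rmax b 1 + 1).
assert (Hc : b < c /\ 1 < c) by (unfold c; generalize (Rmax_l b 1) (Rmax_r b 1); lra).
assert (Hi : 0 < / a) by now apply Rinv_0_lt_compat.
exists (Rpower c (/ a)).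
assert (H1 : 1 < Rpower c (/ a)).
{ rewrite <- (Rpower_1_l (/ a)); apply Rpower_lt_l; lra. }
split; [easy|]; intros x Hx.
apply Rlt_le_trans with (1 := proj1 Hc).
replace c with (Rpower (Rpower c (/ a)) a).
- apply Rle_Rpower_l; lra.
- rewrite Rpower_mult, Rinv_l, Rpower_1; lra.
Qed.

Lemma Rpower_neg_small (C a eps : R) :
  0 < C -> 0 < a -> 0 < eps ->
  exists x0, 1 < x0 /\ forall x, x0 <= x -> C * Rpower x (- a) < eps.
Proof.
intros HC Ha He.
destruct (Rpower_large a (C / eps) Ha) as [x0 [H1 H]].
exists x0; split; [easy|]; intros x Hx; specialize (H x Hx).
rewrite Rpower_Ropp.
assert (Hp := Rpower_pos x a).
apply Rmult_lt_reg_r with (Rpower x a); [easy|].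
rewrite Rmult_assoc, Rinv_l, Rmult_1_r by lra.
apply Rmult_lt_reg_r with (/ eps); [now apply Rinv_0_lt_compat|].
replace (eps * Rpower x a * / eps) with (Rpower x a); [exact H | field; lra].
Qed.

(** Otherwise [M ^ (a - b)] would outgrow the constant [C]. This is how a count valid for all large
    [M] becomes an inequality between exponents. *)
Lemma Rpower_growth_le (C a b : R) (M0 : nat) :
  (forall M : nat, (M0 <= M)%nat -> (1 <= M)%nat -> Rpower (INR M) a <= C * Rpower (INR M) b) -> a <= b.
Proof.
intros H; apply Rnot_lt_le; intros Hab.
destruct (Rpower_large (a - b) C) as [x0 [Hx0 Hx]]; [lra|].
destruct (nfloor_ex x0) as [n Hn]; [lra|].
assert (Hn2 : x0 <= INR (M0 + S n)) by (rewrite plus_INR, S_INR; generalize (pos_INR M0); lra).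
specialize (Hx _ Hn2).
assert (HM := H (M0 + S n)%nat ltac:(lia) ltac:(lia)).
replace a with ((a - b) + b) in HM by ring.
rewrite Rpower_plus in HM; apply Rmult_le_reg_r in HM; [lra | apply Rpower_pos].
Qed.

(** * Intermediate values, pigeonhole and derivative bounds *)

Lemma IVT_closed (f : R -> R) (a b y : R) :
  a <= b -> (forall x, a <= x <= b -> continuity_pt f x) -> f a <= y <= f b ->
  exists x, a <= x <= b /\ f x = y.
Proof.
intros Hab Hc [H1 H2].
destruct (Req_dec (f a) y) as [E1|E1]; [exists a; split; [lra | easy]|].
destruct (Req_dec (f b) y) as [E2|E2]; [exists b; split; [lra | easy]|].
destruct (Req_dec a b) as [E3|E3]; [rewrite E3 in *; lra|].
destruct (IVT_interv (fun x => f x - y) a b) as [z [Hz Ez]]; try lra.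
- intros x Hx; apply continuity_pt_minus; [now apply Hc|].
  apply continuity_pt_const; now intros u v.
- exists z; split; [easy | lra].
Qed.

Lemma IVT_closed_dec (f : R -> R) (a b y : R) :
  a <= b -> (forall x, a <= x <= b -> continuity_pt f x) -> f b <= y <= f a ->
  exists x, a <= x <= b /\ f x = y.
Proof.
intros Hab Hc Hy.
destruct (IVT_closed (fun x => - f x) a b (- y)) as [x [Hx E]]; [easy| |lra|].
- intros x Hx; apply continuity_pt_opp; now apply Hc.
- exists x; split; [easy | lra].
Qed.

Lemma nat_pigeonhole (h : nat -> nat) (N K : nat) :
  (forall i, (i < N)%nat -> (h i < K)%nat) ->
  (forall i j, (i < j < N)%nat -> h i <> h j) -> (N <= K)%nat.
Proof.
intros Hh Hinj.
assert (HL : (length (map h (seq 0 N)) <= length (seq 0 K))%nat).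
{ apply NoDup_incl_length.
  - apply NoDup_map_NoDup_ForallPairs; [|apply seq_NoDup].
    intros i j Hi Hj E; apply in_seq in Hi, Hj.
    destruct (Nat.lt_trichotomy i j) as [L|[L|L]]; [|easy|].
    + exfalso; apply (Hinj i j); [lia | easy].
    + exfalso; apply (Hinj j i); [lia | easy].
  - intros k Hk; apply in_map_iff in Hk; destruct Hk as [i [E Hi]].
    apply in_seq in Hi; apply in_seq; rewrite <- E; generalize (Hh i); lia. }
now rewrite length_map, 2!length_seq in HL.
Qed.

Lemma derive_nonneg_incr (g dg : R -> R) (a b : R) :
  a <= b -> (forall x, a <= x <= b -> is_derive g x (dg x)) ->
  (forall x, a <= x <= b -> 0 <= dg x) -> g a <= g b.
Proof.
intros Hab Hd H0.
destruct (MVT_gen g a b dg) as [x [Hx E]].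
- rewrite Rmin_left, Rmax_right by easy; intros x Hx; apply Hd; lra.
- rewrite Rmin_left, Rmax_right by easy; intros x Hx.
  apply continuity_pt_filterlim; apply (ex_derive_continuous g); exists (dg x); now apply Hd.
- rewrite Rmin_left, Rmax_right in Hx by easy.
  generalize (H0 x Hx); nra.
Qed.

(** [F - g] and [F + g] both have a non-negative derivative. *)
Lemma derive_bound_Lipschitz (g dg F dF : R -> R) (a b : R) :
  a <= b -> (forall x, a <= x <= b -> is_derive g x (dg x)) ->
  (forall x, a <= x <= b -> is_derive F x (dF x)) ->
  (forall x, a <= x <= b -> Rabs (dg x) <= dF x) -> Rabs (g b - g a) <= F b - F a.
Proof.
intros Hab Hg HF Hle.
assert (H1 : F a - g a <= F b - g b).
{ apply (derive_nonneg_incr (fun x => F x - g x) (fun x => dF x - dg x)); [easy| |].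
  - intros x Hx; apply (is_derive_minus F g); [now apply HF | now apply Hg].
  - intros x Hx; generalize (Hle x Hx) (Rle_abs (dg x)); lra. }
assert (H2 : F a + g a <= F b + g b).
{ apply (derive_nonneg_incr (fun x => F x + g x) (fun x => dF x + dg x)); [easy| |].
  - intros x Hx; apply (is_derive_plus F g); [now apply HF | now apply Hg].
  - intros x Hx; generalize (Hle x Hx) (Rle_abs (- dg x)); rewrite Rabs_Ropp; lra. }
apply Rabs_le; lra.
Qed.

(** * Geometry of the spiral *)

Lemma continuity_pt_locally_lt (h : R -> R) (x y : R) :
  continuity_pt h x -> h x < y ->
  exists d, 0 < d /\ forall t, Rabs (t - x) < d -> h t < y.
Proof.
intros Hc Hy; destruct (Hc (y - h x)) as [d [Hd H]]; [lra|].
exists d; split; [easy|]; intros t Ht.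
destruct (Req_dec t x) as [E|E]; [now rewrite E|].
assert (H1 : Rabs (h t - h x) < y - h x).
{ apply H; split; [split; [easy | now apply not_eq_sym] | exact Ht]. }
apply Rabs_def2 in H1; lra.
Qed.

Lemma continuity_pt_locally_gt (h : R -> R) (x y : R) :
  continuity_pt h x -> y < h x ->
  exists d, 0 < d /\ forall t, Rabs (t - x) < d -> y < h t.
Proof.
intros Hc Hy.
destruct (continuity_pt_locally_lt (fun t => - h t) x (- y)) as [d [Hd H]].
- now apply continuity_pt_opp.
- lra.
- exists d; split; [easy|]; intros t Ht; specialize (H t Ht); lra.
Qed.

(** Splits continuity into upper and lower semicontinuity: inverting a monotone relation, as done
    twice below, yields the two one-sided estimates separately. *)
Lemma continuity_pt_of_locally (h : R -> R) (x : R) :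
  (forall e, 0 < e -> exists d, 0 < d /\ forall t, Rabs (t - x) < d -> h t < h x + e) ->
  (forall e, 0 < e -> exists d, 0 < d /\ forall t, Rabs (t - x) < d -> h x - e < h t) ->
  continuity_pt h x.
Proof.
intros Hu Hl e He.
destruct (Hu e He) as [d1 [Hd1 H1]]; destruct (Hl e He) as [d2 [Hd2 H2]].
exists (Rmin d1 d2); split; [now apply Rmin_pos|].
intros t [_ Ht]; change (Rabs (t - x) < Rmin d1 d2) in Ht.
change (Rabs (h t - h x) < e); apply Rabs_def1.
- generalize (H1 t (Rlt_le_trans _ _ _ Ht (Rmin_l _ _))); lra.
- generalize (H2 t (Rlt_le_trans _ _ _ Ht (Rmin_r _ _))); lra.
Qed.

Lemma fst_Cmod (z : C) : Rabs (fst z) <= Cmod z.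
Proof. apply Rle_trans with (2 := Rmax_Cmod z), Rmax_l. Qed.

Lemma snd_Cmod (z : C) : Rabs (snd z) <= Cmod z.
Proof. apply Rle_trans with (2 := Rmax_Cmod z), Rmax_r. Qed.

Lemma Cmod_le_abs (z : C) : Cmod z <= Rabs (fst z) + Rabs (snd z).
Proof.
destruct z as [x y]; unfold Cmod; cbn [fst snd].
generalize (Rabs_pos x) (Rabs_pos y); intros Hx Hy.
rewrite <- (sqrt_Rsqr (Rabs x + Rabs y)) by lra.
apply sqrt_le_1_alt; unfold Rsqr.
rewrite <- (pow2_abs x), <- (pow2_abs y); nra.
Qed.

Lemma Cmod_ge (z : C) (m : R) : 0 <= m -> m ^ 2 <= fst z ^ 2 + snd z ^ 2 -> m <= Cmod z.
Proof.
intros Hm H; unfold Cmod; rewrite <- (sqrt_pow2 m) by easy; now apply sqrt_le_1_alt.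
Qed.

Definition spiral (p q t : R) : C := (Rpower t (- p) * cos t, Rpower t (- q) * sin t).

Lemma spiral_in (p q t : R) : 1 < t -> elliptical_spiral p q (spiral p q t).
Proof. intros Ht; now exists t. Qed.

Lemma Rabs_mul_cos_le (a t : R) : 0 <= a -> Rabs (a * cos t) <= a.
Proof.
intros Ha; rewrite Rabs_mult, (Rabs_pos_eq a) by easy.
assert (H : Rabs (cos t) <= 1) by (apply Rabs_le; generalize (COS_bound t); lra).
nra.
Qed.

Lemma Rabs_mul_sin_le (a t : R) : 0 <= a -> Rabs (a * sin t) <= a.
Proof.
intros Ha; rewrite Rabs_mult, (Rabs_pos_eq a) by easy.
assert (H : Rabs (sin t) <= 1) by (apply Rabs_le; generalize (SIN_bound t); lra).
nra.
Qed.

Lemma spiral_norm_le (p q t : R) :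
  p <= q -> 1 <= t -> Cmod (spiral p q t) <= 2 * Rpower t (- p).
Proof.
intros Hpq Ht; apply Rle_trans with (1 := Cmod_le_abs _); cbn [spiral fst snd].
generalize (Rabs_mul_cos_le (Rpower t (- p)) t (Rlt_le _ _ (Rpower_pos _ _))).
generalize (Rabs_mul_sin_le (Rpower t (- q)) t (Rlt_le _ _ (Rpower_pos _ _))).
assert (H : Rpower t (- q) <= Rpower t (- p)) by (apply Rle_Rpower; lra).
lra.
Qed.

Lemma spiral_norm_ge (p q t : R) :
  p <= q -> 1 <= t -> Rpower t (- q) <= Cmod (spiral p q t).
Proof.
intros Hpq Ht; apply Cmod_ge; [apply Rlt_le, Rpower_pos|]; cbn [spiral fst snd].
assert (H : Rpower t (- q) <= Rpower t (- p)) by (apply Rle_Rpower; lra).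
assert (H0 := Rpower_pos t (- q)).
assert (H1 := sin2_cos2 t); unfold Rsqr in H1.
assert (H2 : Rpower t (- q) ^ 2 <= Rpower t (- p) ^ 2) by (apply pow_incr; lra).
rewrite 2!Rpow_mult_distr.
replace (Rpower t (- q) ^ 2) with (Rpower t (- q) ^ 2 * (sin t * sin t + cos t * cos t)) at 1
  by (rewrite H1; ring).
assert (H3 := pow2_ge_0 (cos t)).
nra.
Qed.

Lemma cos_INR_2PI (n : nat) : cos (2 * PI * INR n) = 1.
Proof.
replace (2 * PI * INR n) with (0 + 2 * INR n * PI) by ring; now rewrite cos_period, cos_0.
Qed.

Lemma spiral_norm_axis (p q : R) (n : nat) :
  Rpower (2 * PI * INR n) (- p) <= Cmod (spiral p q (2 * PI * INR n)).
Proof.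
apply Rle_trans with (2 := fst_Cmod _); cbn [spiral fst].
rewrite cos_INR_2PI, Rmult_1_r; apply Rle_abs.
Qed.

(** [ellipse_level p q v z = 1] is the ellipse with semi-axes [v ^ - p] and
    [v ^ - q], which meets the spiral only at parameter [v]; this recovers the
    parameter continuously from the point. *)
Definition ellipse_level (p q v : R) (z : C) : R :=
  fst z ^ 2 * Rpower v (2 * p) + snd z ^ 2 * Rpower v (2 * q).

Lemma ellipse_level_spiral (p q u v : R) : 0 < u -> 0 < v ->
  ellipse_level p q v (spiral p q u) =
  cos u ^ 2 * Rpower (v / u) (2 * p) + sin u ^ 2 * Rpower (v / u) (2 * q).
Proof.
intros Hu Hv; unfold ellipse_level; cbn [spiral fst snd].
assert (E : forall a, Rpower u (- a) ^ 2 * Rpower v (2 * a) = Rpower (v / u) (2 * a)).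
{ intros a; replace (Rpower u (- a) ^ 2) with (Rpower u (- a) * Rpower u (- a)) by ring.
  rewrite <- Rpower_plus; unfold Rpower; rewrite <- exp_plus, ln_div by easy.
  f_equal; ring. }
rewrite <- (E p), <- (E q); ring.
Qed.

(** By [ellipse_level_spiral] the level is an average, with weights [cos u ^ 2] and [sin u ^ 2], of
    two positive powers of [v / u > 1]. The next lemma is the case [v / u < 1]. *)
Lemma ellipse_level_gt (p q u v : R) : 0 < p -> 0 < q -> 0 < u < v ->
  1 < ellipse_level p q v (spiral p q u).
Proof.
intros Hp Hq [Hu Huv]; rewrite ellipse_level_spiral by lra.
assert (Hr : 1 < v / u).
{ apply Rmult_lt_reg_r with u; [easy|]; unfold Rdiv; rewrite Rmult_assoc, Rinv_l; lra. }
assert (H1 : 1 < Rpower (v / u) (2 * p)) by (rewrite <- (Rpower_1_l (2 * p)); apply Rpower_lt_l; lra).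
assert (H2 : 1 < Rpower (v / u) (2 * q)) by (rewrite <- (Rpower_1_l (2 * q)); apply Rpower_lt_l; lra).
assert (H := sin2_cos2 u); rewrite 2!Rsqr_pow2 in H.
generalize (pow2_ge_0 (cos u)) (pow2_ge_0 (sin u)); intros H3 H4.
destruct (Rle_lt_dec (cos u ^ 2) 0); nra.
Qed.

Lemma ellipse_level_lt (p q u v : R) : 0 < p -> 0 < q -> 0 < v < u ->
  ellipse_level p q v (spiral p q u) < 1.
Proof.
intros Hp Hq [Hv Huv]; rewrite ellipse_level_spiral by lra.
assert (Hr : v / u < 1).
{ apply Rmult_lt_reg_r with u; [lra|]; unfold Rdiv; rewrite Rmult_assoc, Rinv_l; lra. }
assert (Hr0 : 0 < v / u) by (apply Rdiv_lt_0_compat; lra).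
assert (H1 : Rpower (v / u) (2 * p) < 1) by (rewrite <- (Rpower_1_l (2 * p)); apply Rpower_lt_l; lra).
assert (H2 : Rpower (v / u) (2 * q) < 1) by (rewrite <- (Rpower_1_l (2 * q)); apply Rpower_lt_l; lra).
assert (H := sin2_cos2 u); rewrite 2!Rsqr_pow2 in H.
generalize (pow2_ge_0 (cos u)) (pow2_ge_0 (sin u)); intros H3 H4.
destruct (Rle_lt_dec (cos u ^ 2) 0); nra.
Qed.

(** For fixed [v] the level of [z t] is continuous in [t]. At [t0] it is above 1 for [v = g t0 + e]
    and below 1 for [v = g t0 - e]; this persists nearby and keeps [g t] between the two values. *)
Lemma spiral_parameter_continuous (p q : R) (z : R -> C) (g : R -> R) (t0 : R) :
  0 < p -> 0 < q -> (forall t, 1 < g t) ->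
  (exists d, 0 < d /\ forall t, Rabs (t - t0) < d -> z t = spiral p q (g t)) ->
  continuity_pt (fun t => fst (z t)) t0 -> continuity_pt (fun t => snd (z t)) t0 ->
  continuity_pt g t0.
Proof.
intros Hp Hq Hg [d [Hd Hz]] C1 C2.
assert (Hz0 : z t0 = spiral p q (g t0)) by (apply Hz; rewrite Rminus_diag, Rabs_R0; easy).
assert (HE : forall v, continuity_pt (fun t => ellipse_level p q v (z t)) t0).
{ intros v; unfold ellipse_level.
  apply (continuity_pt_plus (fun t => fst (z t) ^ 2 * _) (fun t => snd (z t) ^ 2 * _)).
  - apply (continuity_pt_mult (fun t => fst (z t) ^ 2) (fun _ => Rpower v (2 * p))).
    + apply (continuity_pt_comp (fun t => fst (z t)) (fun x => x ^ 2)); [easy|].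
      apply derivable_continuous_pt, derivable_pt_pow.
    + apply continuity_pt_const; now intros ? ?.
  - apply (continuity_pt_mult (fun t => snd (z t) ^ 2) (fun _ => Rpower v (2 * q))).
    + apply (continuity_pt_comp (fun t => snd (z t)) (fun x => x ^ 2)); [easy|].
      apply derivable_continuous_pt, derivable_pt_pow.
    + apply continuity_pt_const; now intros ? ?. }
assert (Hg0 := Hg t0).
apply continuity_pt_of_locally; intros e He.
- destruct (continuity_pt_locally_gt _ t0 1 (HE (g t0 + e))) as [d1 [Hd1 H1]].
  { rewrite Hz0; apply ellipse_level_gt; lra. }
  exists (Rmin d d1); split; [now apply Rmin_pos|]; intros t Ht.
  specialize (H1 t (Rlt_le_trans _ _ _ Ht (Rmin_r _ _))).
  rewrite (Hz t (Rlt_le_trans _ _ _ Ht (Rmin_l _ _))) in H1.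
  apply Rnot_le_lt; intros [L|L].
  + generalize (ellipse_level_lt p q (g t) (g t0 + e) Hp Hq); lra.
  + rewrite L, ellipse_level_spiral in H1 by (generalize (Hg t); lra).
    unfold Rdiv in H1; rewrite Rinv_r, 2!Rpower_1_l in H1 by (generalize (Hg t); lra).
    generalize (sin2_cos2 (g t)); rewrite 2!Rsqr_pow2; lra.
- destruct (Rle_lt_dec (g t0 - e) 1) as [L0|L0].
  (* The level argument needs a positive [v]; here the lower estimate already follows from
     [1 < g t]. *)
  { exists 1; split; [lra|]; intros t _; generalize (Hg t); lra. }
  destruct (continuity_pt_locally_lt _ t0 1 (HE (g t0 - e))) as [d1 [Hd1 H1]].
  { rewrite Hz0; apply ellipse_level_lt; lra. }
  exists (Rmin d d1); split; [now apply Rmin_pos|]; intros t Ht.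
  specialize (H1 t (Rlt_le_trans _ _ _ Ht (Rmin_r _ _))).
  rewrite (Hz t (Rlt_le_trans _ _ _ Ht (Rmin_l _ _))) in H1.
  apply Rnot_le_lt; intros [L|L].
  + generalize (ellipse_level_gt p q (g t) (g t0 - e) Hp Hq); generalize (Hg t); lra.
  + rewrite <- L, ellipse_level_spiral in H1 by (generalize (Hg t); lra).
    unfold Rdiv in H1; rewrite Rinv_r, 2!Rpower_1_l in H1 by (generalize (Hg t); lra).
    generalize (sin2_cos2 (g t)); rewrite 2!Rsqr_pow2; lra.
Qed.

Lemma spiral_fst_derive (p q t : R) : 0 < t ->
  is_derive (fun t => fst (spiral p q t)) t
    (- p * Rpower t (- p - 1) * cos t + Rpower t (- p) * (- sin t)).
Proof.
intros Ht; cbn [spiral fst].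
apply (is_derive_mult (fun t => Rpower t (- p)) cos t).
- now apply is_derive_Rpower.
- apply is_derive_cos.
- intros; apply Rmult_comm.
Qed.

Lemma spiral_snd_derive (p q t : R) : 0 < t ->
  is_derive (fun t => snd (spiral p q t)) t
    (- q * Rpower t (- q - 1) * sin t + Rpower t (- q) * cos t).
Proof.
intros Ht; cbn [spiral snd].
apply (is_derive_mult (fun t => Rpower t (- q)) sin t).
- now apply is_derive_Rpower.
- apply is_derive_sin.
- intros; apply Rmult_comm.
Qed.

Lemma spiral_continuous (p q t : R) : 0 < t ->
  continuity_pt (fun t => fst (spiral p q t)) t /\ continuity_pt (fun t => snd (spiral p q t)) t.
Proof.
intros Ht; split; apply continuity_pt_filterlim.
- apply (ex_derive_continuous (fun t => fst (spiral p q t))); eexists; now apply spiral_fst_derive.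
- apply (ex_derive_continuous (fun t => snd (spiral p q t))); eexists; now apply spiral_snd_derive.
Qed.

(** [arc_bound q w] grows at least as fast as the coordinates of the spiral as
    soon as [1 - p <= w]; the freedom in [w] avoids the logarithm at [p = 1]. *)
Definition arc_bound (q w t : R) : R := (q + 1) / w * Rpower t w.

Lemma arc_bound_derive (q w t : R) : 0 < w -> 0 < t ->
  is_derive (arc_bound q w) t ((q + 1) * Rpower t (w - 1)).
Proof.
intros Hw Ht.
replace ((q + 1) * Rpower t (w - 1)) with ((q + 1) / w * (w * Rpower t (w - 1))) by (field; lra).
apply (is_derive_scal (fun t => Rpower t w)); now apply is_derive_Rpower.
Qed.

Lemma arc_bound_incr (q w a b : R) : 0 < q -> 0 < w -> 1 <= a <= b ->
  arc_bound q w a <= arc_bound q w b.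
Proof.
intros Hq Hw [Ha Hab]; unfold arc_bound.
apply Rmult_le_compat_l; [apply Rlt_le, Rdiv_lt_0_compat; lra | apply Rle_Rpower_l; lra].
Qed.

(** For [p <= k] and [1 <= x], both [x ^ (- k - 1)] and [x ^ (- k)] are at most [x ^ (w - 1)], so
    each coordinate moves at most as fast as [arc_bound]. The factor 2 adds up the two
    coordinates. *)
Lemma spiral_arc_bound (p q w a b : R) :
  0 < p -> p <= q -> 0 < w -> 1 - p <= w -> 1 <= a <= b ->
  Cmod (spiral p q b - spiral p q a)%C <= 2 * (arc_bound q w b - arc_bound q w a).
Proof.
intros Hp Hpq Hw Hpw [Ha Hab].
assert (HR : forall x e, 1 <= x -> e <= w - 1 -> 0 < Rpower x e <= Rpower x (w - 1)).
{ intros x e Hx He; split; [apply Rpower_pos | apply Rle_Rpower; lra]. }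
assert (Hcomb : forall x k c d, 1 <= x -> p <= k <= q -> -1 <= c <= 1 -> -1 <= d <= 1 ->
  Rabs (- k * Rpower x (- k - 1) * c + Rpower x (- k) * d) <= (q + 1) * Rpower x (w - 1)).
{ intros x k c d Hx Hk Hc Hd.
  generalize (HR x (- k - 1) Hx ltac:(lra)) (HR x (- k) Hx ltac:(lra)).
  generalize (Rpower x (- k - 1)) (Rpower x (- k)) (Rpower x (w - 1)); intros A B E HA HB.
  assert (H1 : k * A <= q * E) by (apply Rmult_le_compat; lra).
  assert (H2 : 0 < k * A) by (apply Rmult_lt_0_compat; lra).
  apply Rabs_le; split; nra. }
apply Rle_trans with (1 := Cmod_le_abs _).
assert (H1 : Rabs (fst (spiral p q b) - fst (spiral p q a)) <= arc_bound q w b - arc_bound q w a).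
{ apply (derive_bound_Lipschitz (fun t => fst (spiral p q t)) _ (arc_bound q w) _ a b Hab
    (fun x Hx => spiral_fst_derive p q x ltac:(lra))
    (fun x Hx => arc_bound_derive q w x Hw ltac:(lra))).
  intros x Hx; generalize (COS_bound x) (SIN_bound x); intros; apply Hcomb; lra. }
assert (H2 : Rabs (snd (spiral p q b) - snd (spiral p q a)) <= arc_bound q w b - arc_bound q w a).
{ apply (derive_bound_Lipschitz (fun t => snd (spiral p q t)) _ (arc_bound q w) _ a b Hab
    (fun x Hx => spiral_snd_derive p q x ltac:(lra))
    (fun x Hx => arc_bound_derive q w x Hw ltac:(lra))).
  intros x Hx; generalize (COS_bound x) (SIN_bound x); intros; apply Hcomb; lra. }
change (fst (spiral p q b - spiral p q a)%C) with (fst (spiral p q b) - fst (spiral p q a)).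
change (snd (spiral p q b - spiral p q a)%C) with (snd (spiral p q b) - snd (spiral p q a)).
lra.
Qed.

(** * Counting separated points *)

Lemma Rpower_neg_gap (s B u v : R) :
  0 < s -> 0 < u -> u + 1 <= v <= B ->
  s * Rpower B (- s - 1) <= Rpower u (- s) - Rpower v (- s).
Proof.
intros Hs Hu [Huv HvB].
destruct (MVT_gen (fun t => Rpower t (- s)) u v (fun t => - s * Rpower t (- s - 1))) as [x [Hx E]].
- rewrite Rmin_left, Rmax_right by lra; intros x Hx; apply is_derive_Rpower; lra.
- rewrite Rmin_left, Rmax_right by lra; intros x Hx; apply continuity_pt_Rpower; lra.
- rewrite Rmin_left, Rmax_right in Hx by lra.
  assert (H1 : Rpower B (- s - 1) <= Rpower x (- s - 1)).
  { replace (- s - 1) with (- (s + 1)) by ring; apply Rpower_neg_le_l; lra. }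
  assert (H2 := Rpower_pos B (- s - 1)).
  assert (H3 : s * Rpower B (- s - 1) <= s * Rpower x (- s - 1)) by (apply Rmult_le_compat_l; lra).
  assert (H4 : 0 < s * Rpower B (- s - 1)) by (apply Rmult_lt_0_compat; lra).
  nra.
Qed.

(** On the first quarter of turn [n] the abscissa goes from at least [B ^ - p] to 0, so it meets
    [x]. Taking [x] at most half of [B ^ - p] forces [cos u <= 1 / 2], which keeps [sin u] away from
    0. *)
Lemma spiral_vertical_hit (p q B x : R) (n : nat) :
  0 < p -> (1 <= n)%nat -> 2 * PI * INR n + PI / 2 <= B -> 0 <= x -> 2 * x <= Rpower B (- p) ->
  exists u, 2 * PI * INR n <= u <= 2 * PI * INR n + PI / 2 /\
    fst (spiral p q u) = x /\ 0 <= cos u /\ 1 / 2 <= sin u.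
Proof.
intros Hp Hn HB Hx H2x.
assert (HPI := PI_RGT_0).
assert (Hn1 : 1 <= INR n) by (now apply (le_INR 1)).
assert (Hpos : 0 < 2 * PI * INR n) by nra.
destruct (IVT_closed_dec (fun t => fst (spiral p q t)) (2 * PI * INR n) (2 * PI * INR n + PI / 2) x)
  as [u [Hu E]].
- lra.
- intros t Ht; apply (spiral_continuous p q t); lra.
- cbn [spiral fst]; rewrite cos_INR_2PI; split.
  + replace (2 * PI * INR n + PI / 2) with (PI / 2 + 2 * INR n * PI) by ring.
    rewrite cos_period, cos_PI2; lra.
  + assert (H : Rpower B (- p) <= Rpower (2 * PI * INR n) (- p)) by (apply Rpower_neg_le_l; lra).
    lra.
- exists u; split; [easy|]; split; [easy|].
  assert (Eu : u = (u - 2 * PI * INR n) + 2 * INR n * PI) by ring.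
  assert (Hc : 0 <= cos u) by (rewrite Eu, cos_period; apply cos_ge_0; lra).
  assert (Hs : 0 <= sin u) by (rewrite Eu, sin_period; apply sin_ge_0; lra).
  split; [easy|].
  assert (H : Rpower B (- p) <= Rpower u (- p)) by (apply Rpower_neg_le_l; lra).
  cbn [spiral fst] in E.
  assert (H0 := Rpower_pos u (- p)).
  assert (Hc2 : cos u <= 1 / 2) by (apply Rmult_le_reg_l with (1 := H0); lra).
  assert (H1 := sin2_cos2 u); unfold Rsqr in H1; nra.
Qed.

(** On a common vertical line the later point has the smaller factor [v ^ - p], hence the larger
    cosine and the smaller sine. The heights therefore differ by at least
    [(u ^ - q - v ^ - q) * sin u]. *)
Lemma spiral_vertical_gap (p q B u v : R) :
  0 < p -> 0 < q -> 0 < u -> u + 1 <= v <= B ->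
  fst (spiral p q u) = fst (spiral p q v) ->
  0 <= cos u -> 1 / 2 <= sin u -> 0 <= sin v ->
  q / 2 * Rpower B (- q - 1) <= snd (spiral p q u) - snd (spiral p q v).
Proof.
intros Hp Hq Hu Huv E Hcu Hsu Hsv; cbn [spiral fst snd] in *.
assert (H0 := Rpower_pos v (- p)).
assert (H1 : Rpower v (- p) <= Rpower u (- p)) by (apply Rpower_neg_le_l; lra).
assert (Hc : cos u <= cos v).
{ apply Rmult_le_reg_l with (1 := H0); rewrite <- E; now apply Rmult_le_compat_r. }
assert (Hs : sin v <= sin u).
{ generalize (sin2_cos2 u) (sin2_cos2 v); unfold Rsqr; nra. }
assert (H2 := Rpower_neg_gap q B u v Hq Hu Huv).
assert (H3 := Rpower_pos v (- q)).
assert (H4 := Rpower_pos B (- q - 1)).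
assert (H5 : Rpower v (- q) * sin v <= Rpower v (- q) * sin u) by (apply Rmult_le_compat_l; lra).
assert (H6 : 0 < q * Rpower B (- q - 1)) by (apply Rmult_lt_0_compat; lra).
nra.
Qed.

(** * Counting the turns covered by an arc *)

(** Replacing the distance by any positive upper bound [d] settles the case [x = y] here, so that no
    power of 0 occurs later. *)
Lemma Holder_modulus (alpha : R) (f : C -> C) (X : C -> Prop) :
  0 < alpha -> Holder_on alpha f X ->
  exists c, 0 < c /\ forall x y d, X x -> X y -> 0 < d -> Cmod (x - y)%C <= d ->
    Cmod (f x - f y)%C <= c * Rpower d alpha.
Proof.
intros Ha [c [Hc H]]; exists c; split; [easy|]; intros x y d Hx Hy Hd Hxy.
assert (Hp := Rpower_pos d alpha).
destruct (Cmod_ge_0 (x - y)%C) as [L|E].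
- apply Rle_trans with (1 := H x y Hx Hy), Rmult_le_compat_l; [lra|].
  apply Rle_Rpower_l; lra.
- assert (Exy : x = y).
  { apply eq_sym, Cmod_eq_0 in E; rewrite <- (Cplus_0_r y), <- E; ring. }
  rewrite Exy; replace (f y - f y)%C with (RtoC 0) by ring.
  rewrite Cmod_0; nra.
Qed.

Section Counting.

Variables (p q r s alpha c w : R) (f : C -> C).
Hypotheses (hp : 0 < p) (hpq : p <= q) (hr : 0 < r) (hrs : r <= s).
Hypotheses (halpha : 0 < alpha) (hc : 0 < c) (hw : 0 < w) (hpw : 1 - p <= w).
Hypothesis hf : forall x y d, elliptical_spiral p q x -> elliptical_spiral p q y ->
  0 < d -> Cmod (x - y)%C <= d -> Cmod (f x - f y)%C <= c * Rpower d alpha.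

Definition covers_turns (N M : nat) (a b : R) : Prop :=
  forall u, 2 * PI * INR N <= u <= 2 * PI * INR (N + M) ->
  exists t, 1 < t /\ a <= t <= b /\ f (spiral p q t) = spiral r s u.

(** Index [i] stands for the point of turn [N + i / J] on the vertical line of abscissa
    [(i mod J) * eps]. Any two of these [M * J] points differ by at least [eps] in some coordinate,
    whereas preimages in a common piece of diameter [d] have images closer than [eps]; so each piece
    serves one index. All parameters involved stay below [14 * PI * M], hence below [60 * M]. *)
Lemma covered_turns_count (N M J : nat) (a b d : R) :
  let eps := s / 2 * Rpower (60 * INR M) (- s - 1) in
  (1 <= M)%nat -> (M <= N <= 6 * M)%nat -> 1 <= a <= b -> covers_turns N M a b ->
  0 < d -> c * Rpower d alpha < eps ->
  2 * (INR (J - 1) * eps) <= Rpower (60 * INR M) (- r) ->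
  INR (M * J) <= 2 * (arc_bound q w b - arc_bound q w a) / d + 1.
Proof.
intros eps HM HN Hab Hcov Hd Hde HJ.
assert (HPI := PI_RGT_0); assert (HPI4 := PI_4); assert (HPI2 := PI2_1).
assert (Heps : 0 < eps) by (apply Rmult_lt_0_compat; [lra | apply Rpower_pos]).
assert (HMR : 1 <= INR M) by now apply (le_INR 1).
set (Phi := arc_bound q w) in *.
(* A pair holds the parameter [u] of the target point and the parameter [t] of a preimage. Indices
   out of range get the dummy [(0, 0)], so that choice yields a total function. *)
assert (Hsample : forall i, exists ut : R * R, (i < M * J)%nat ->
  (2 * PI * INR (N + i / J) <= fst ut <= 2 * PI * INR (N + i / J) + PI / 2 /\
   fst (spiral r s (fst ut)) = INR (i mod J) * eps /\ 0 <= cos (fst ut) /\ 1 / 2 <= sin (fst ut)) /\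
  1 < snd ut /\ a <= snd ut <= b /\ f (spiral p q (snd ut)) = spiral r s (fst ut)).
{ intros i; destruct (Nat.lt_ge_cases i (M * J)) as [Hi|Hi]; [|exists (0, 0); lia].
  assert (HJ0 : (J <> 0)%nat) by lia.
  assert (Hn : (i / J <= M - 1)%nat).
  { assert (i / J < M)%nat by (apply Nat.Div0.div_lt_upper_bound; lia); lia. }
  assert (HnR : INR (N + i / J) <= 7 * INR M - 1).
  { assert (Hle : (N + i / J + 1 <= 7 * M)%nat) by lia.
    apply le_INR in Hle; rewrite plus_INR, mult_INR in Hle; simpl in Hle; lra. }
  assert (Hj : (i mod J <= J - 1)%nat) by (generalize (Nat.mod_upper_bound i J HJ0); lia).
  destruct (spiral_vertical_hit r s (60 * INR M) (INR (i mod J) * eps) (N + i / J)) as [u [Hu Hu']];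
    [easy | lia | nra | apply Rmult_le_pos; [apply pos_INR | lra] | |].
  { apply Rle_trans with (2 := HJ), Rmult_le_compat_l, Rmult_le_compat_r; try lra.
    now apply le_INR. }
  destruct (Hcov u) as [t Ht].
  { split.
    - apply Rle_trans with (2 := proj1 Hu), Rmult_le_compat_l; [lra | apply le_INR; lia].
    - apply Rle_trans with (1 := proj2 Hu).
      assert (Hle : (N + i / J + 1 <= N + M)%nat) by lia.
      apply le_INR in Hle; rewrite (plus_INR (N + i / J)) in Hle; simpl (INR 1) in Hle; nra. }
  exists (u, t); intros _; cbn [fst snd]; tauto. }
set (ut := fun i => proj1_sig (constructive_indefinite_description _ (Hsample i))).
assert (Hut := fun i => proj2_sig (constructive_indefinite_description _ (Hsample i))).
fold ut in Hut; change (forall i, (i < M * J)%nat ->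
  (2 * PI * INR (N + i / J) <= fst (ut i) <= 2 * PI * INR (N + i / J) + PI / 2 /\
   fst (spiral r s (fst (ut i))) = INR (i mod J) * eps /\ 0 <= cos (fst (ut i)) /\ 1 / 2 <= sin (fst (ut i))) /\
  1 < snd (ut i) /\ a <= snd (ut i) <= b /\ f (spiral p q (snd (ut i))) = spiral r s (fst (ut i))) in Hut.
clearbody ut; clear Hsample Hcov.
(* Position along the arc in units of [d / 2]: by [spiral_arc_bound], points less than one unit
   apart are at distance at most [d]. *)
set (pos := fun i => 2 * (Phi (snd (ut i)) - Phi a) / d).
assert (Hpos : forall i, (i < M * J)%nat -> 0 <= pos i <= 2 * (Phi b - Phi a) / d).
{ intros i Hi; destruct (Hut i Hi) as [_ [_ [Ht _]]].
  assert (H1 : Phi a <= Phi (snd (ut i))) by (apply arc_bound_incr; lra).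
  assert (H2 : Phi (snd (ut i)) <= Phi b) by (apply arc_bound_incr; lra).
  assert (Hi' := Rinv_0_lt_compat d Hd).
  unfold pos, Rdiv; split; [apply Rmult_le_pos; lra | apply Rmult_le_compat_r; lra]. }
assert (Hbin : forall i, exists k : nat, (i < M * J)%nat -> INR k <= pos i < INR k + 1).
{ intros i; destruct (Nat.lt_ge_cases i (M * J)) as [Hi|Hi]; [|exists 0%nat; lia].
  destruct (nfloor_ex (pos i)) as [k Hk]; [now apply Hpos|]; now exists k. }
set (bin := fun i => proj1_sig (constructive_indefinite_description _ (Hbin i))).
assert (Hb : forall i, (i < M * J)%nat -> INR (bin i) <= pos i < INR (bin i) + 1)
  by (intros i; exact (proj2_sig (constructive_indefinite_description _ (Hbin i)))).
clearbody bin; clear Hbin.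
(* The bins are numbered from 0 to [K], whence the [+ 1] in the bound. *)
destruct (nfloor_ex (2 * (Phi b - Phi a) / d)) as [K HK].
{ assert (Phi a <= Phi b) by (apply arc_bound_incr; lra).
  apply Rmult_le_pos; [lra | now apply Rlt_le, Rinv_0_lt_compat]. }
apply Rle_trans with (INR (K + 1)); [|rewrite plus_INR; simpl (INR 1); lra].
apply le_INR, (nat_pigeonhole bin).
- intros i Hi; apply INR_lt; rewrite plus_INR; simpl (INR 1).
  generalize (Hb i Hi) (Hpos i Hi); lra.
- intros i j [Hij Hj] E.
  assert (Hi : (i < M * J)%nat) by lia.
  assert (Hpq := Hb i Hi); assert (Hpq' := Hb j Hj); rewrite E in Hpq.
  assert (Hphi : Rabs (Phi (snd (ut i)) - Phi (snd (ut j))) < d / 2).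
  { assert (Ei : Phi (snd (ut i)) - Phi (snd (ut j)) = d / 2 * (pos i - pos j)).
    { unfold pos; field; lra. }
    rewrite Ei, Rabs_mult, (Rabs_pos_eq (d / 2)) by lra.
    assert (Rabs (pos i - pos j) < 1) by (apply Rabs_def1; lra).
    nra. }
  destruct (Hut i Hi) as [[Hui [Exi [Hci Hsi]]] [Hti1 [Hti Efi]]].
  destruct (Hut j Hj) as [[Huj [Exj [Hcj Hsj]]] [Htj1 [Htj Efj]]].
  assert (HX : Cmod (spiral p q (snd (ut i)) - spiral p q (snd (ut j)))%C <= d).
  { destruct (Rle_lt_dec (snd (ut j)) (snd (ut i))) as [L|L].
    - apply Rle_trans with (1 := spiral_arc_bound p q w _ _ hp hpq hw hpw (conj (Rlt_le _ _ Htj1) L)).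
      fold Phi; generalize (Rle_abs (Phi (snd (ut i)) - Phi (snd (ut j)))); lra.
    - replace (spiral p q (snd (ut i)) - spiral p q (snd (ut j)))%C
        with (- (spiral p q (snd (ut j)) - spiral p q (snd (ut i))))%C by ring.
      rewrite Cmod_opp.
      apply Rle_trans with (1 := spiral_arc_bound p q w _ _ hp hpq hw hpw (conj (Rlt_le _ _ Hti1) (Rlt_le _ _ L))).
      fold Phi; generalize (Rle_abs (- (Phi (snd (ut i)) - Phi (snd (ut j))))); rewrite Rabs_Ropp; lra. }
  assert (HY := hf _ _ d (spiral_in p q _ Hti1) (spiral_in p q _ Htj1) Hd HX).
  rewrite Efi, Efj in HY.
  assert (Hdx := Rle_trans _ _ _ (fst_Cmod _) HY).
  assert (Hdy := Rle_trans _ _ _ (snd_Cmod _) HY).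
  change (Rabs (fst (spiral r s (fst (ut i))) - fst (spiral r s (fst (ut j)))) <= c * Rpower d alpha) in Hdx.
  change (Rabs (snd (spiral r s (fst (ut i))) - snd (spiral r s (fst (ut j)))) <= c * Rpower d alpha) in Hdy.
  assert (HJ0 : (J <> 0)%nat) by lia.
  (* Abscissas are integer multiples of [eps], so images closer than [eps] share their vertical
     line. Then [i < j] puts them on different turns, and [spiral_vertical_gap] gives the
     contradiction. *)
  assert (Emod : (i mod J = j mod J)%nat).
  { rewrite Exi, Exj in Hdx.
    assert (Hm : Rabs (INR (i mod J) - INR (j mod J)) < 1).
    { apply Rmult_lt_reg_r with (1 := Heps).
      rewrite <- (Rabs_pos_eq eps) at 1 by lra; rewrite <- Rabs_mult, Rmult_minus_distr_r; lra. }
    apply Rabs_def2 in Hm.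
    assert (i mod J < j mod J + 1)%nat by (apply INR_lt; rewrite plus_INR; simpl (INR 1); lra).
    assert (j mod J < i mod J + 1)%nat by (apply INR_lt; rewrite plus_INR; simpl (INR 1); lra).
    lia. }
  assert (Hdiv : (i / J + 1 <= j / J)%nat).
  { generalize (Nat.div_mod i J HJ0) (Nat.div_mod j J HJ0); rewrite Emod; nia. }
  assert (HdivR : INR (N + i / J) + 1 <= INR (N + j / J)).
  { change 1 with (INR 1); rewrite <- plus_INR; apply le_INR; lia. }
  assert (Hjle : INR (N + j / J) <= 7 * INR M - 1).
  { assert (Hlt : (j / J < M)%nat) by (apply Nat.Div0.div_lt_upper_bound; lia).
    assert (Hle : (N + j / J + 1 <= 7 * M)%nat) by lia.
    apply le_INR in Hle; rewrite plus_INR, mult_INR in Hle; simpl in Hle; lra. }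
  assert (HN1 : 1 <= INR (N + i / J)) by (apply (le_INR 1); lia).
  assert (Hgap : eps <= snd (spiral r s (fst (ut i))) - snd (spiral r s (fst (ut j)))).
  { apply spiral_vertical_gap; try lra; try nra.
    - rewrite Exi, Exj; now rewrite Emod. }
  generalize (Rle_abs (snd (spiral r s (fst (ut i))) - snd (spiral r s (fst (ut j))))); lra.
Qed.

(** With [eps] of order [M ^ (- 1 - s)], [d] of order [M ^ (- (1 + s) / alpha)] and about
    [M ^ (1 + s - r)] vertical lines, the count compares [M ^ (2 + s - r)] with [M ^ e / d]. *)
Lemma covered_turns_exponent (C0 e : R) (M0 : nat) :
  0 <= C0 -> 0 <= e ->
  (forall M : nat, (M0 <= M)%nat -> (1 <= M)%nat -> exists (N : nat) (a b : R),
    (M <= N <= 6 * M)%nat /\ 1 <= a <= b /\ covers_turns N M a b /\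
    arc_bound q w b - arc_bound q w a <= C0 * Rpower (INR M) e) ->
  2 + s - r <= e + (1 + s) / alpha.
Proof.
intros HC He H.
(* [k1], [k2] and [k3] are the factors of the powers of [M] in [eps], in [d] and in the number of
   lines; [k2] is chosen so that [c * d ^ alpha = eps / 2]. *)
set (k1 := s / 2 * Rpower 60 (- s - 1)).
assert (Hk1 : 0 < k1) by (apply Rmult_lt_0_compat; [lra | apply Rpower_pos]).
set (k2 := Rpower (k1 / (2 * c)) (/ alpha)).
assert (Hk2 : 0 < k2) by apply Rpower_pos.
set (k3 := Rpower 60 (- r) / (2 * k1)).
assert (Hk3 : 0 < k3) by (apply Rdiv_lt_0_compat; [apply Rpower_pos | lra]).
apply (Rpower_growth_le ((2 * C0 / k2 + 1) / k3) _ _ M0).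
intros M HM HM1.
destruct (H M HM HM1) as [N [a [b [HN [Hab [Hcov Harc]]]]]].
assert (HMR : 1 <= INR M) by now apply (le_INR 1).
set (m := INR M) in *.
assert (Hinva : 0 < / alpha) by now apply Rinv_0_lt_compat.
set (eps := s / 2 * Rpower (60 * m) (- s - 1)).
assert (Eeps : eps = k1 * Rpower m (- s - 1)).
{ unfold eps, k1; rewrite <- Rpower_mult_distr by lra; ring. }
assert (Heps : 0 < eps) by (apply Rmult_lt_0_compat; [lra | apply Rpower_pos]).
set (d := k2 * Rpower m (- ((1 + s) / alpha))).
assert (Hd : 0 < d) by (apply Rmult_lt_0_compat; [lra | apply Rpower_pos]).
assert (Ed : c * Rpower d alpha = eps / 2).
{ unfold d; rewrite <- Rpower_mult_distr by (try easy; apply Rpower_pos).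
  unfold k2; rewrite 2!Rpower_mult, Rinv_l, Rpower_1 by (try lra; apply Rdiv_lt_0_compat; lra).
  replace (- ((1 + s) / alpha) * alpha) with (- s - 1) by (field; lra).
  rewrite Eeps; field; lra. }
assert (Hratio : Rpower (60 * m) (- r) / (2 * eps) = k3 * Rpower m (1 + s - r)).
{ rewrite Eeps, <- Rpower_mult_distr by lra; unfold k3.
  replace (1 + s - r) with (- r + - (- s - 1)) by ring.
  rewrite Rpower_plus, (Rpower_Ropp m (- s - 1)).
  assert (Hp := Rpower_pos m (- s - 1)); field; lra. }
destruct (nfloor_ex (Rpower (60 * m) (- r) / (2 * eps))) as [J HJ].
{ apply Rlt_le, Rdiv_lt_0_compat; [apply Rpower_pos | lra]. }
(* Lines at [0, eps, ..., J * eps] fit, and their number [J + 1] exceeds the ratio whose floor is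
   [J], so rounding loses nothing. *)
assert (Hcount := covered_turns_count N M (J + 1) a b d HM1 HN Hab Hcov Hd).
cbv zeta in Hcount; fold m eps in Hcount.
replace (J + 1 - 1)%nat with J in Hcount by lia.
specialize (Hcount ltac:(lra)).
assert (HJ' : 2 * (INR J * eps) <= Rpower (60 * m) (- r)).
{ apply Rmult_le_reg_r with (/ (2 * eps)); [apply Rinv_0_lt_compat; lra|].
  replace (2 * (INR J * eps) * / (2 * eps)) with (INR J) by (field; lra); apply HJ. }
specialize (Hcount HJ').
rewrite mult_INR, plus_INR in Hcount; simpl (INR 1) in Hcount; fold m in Hcount.
rewrite Hratio in HJ.
assert (HL : m * (k3 * Rpower m (1 + s - r)) <= m * (INR J + 1)) by (apply Rmult_le_compat_l; lra).
assert (Em : m * (k3 * Rpower m (1 + s - r)) = k3 * Rpower m (2 + s - r)).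
{ replace (2 + s - r) with (1 + (1 + s - r)) by ring.
  rewrite (Rpower_plus 1), Rpower_1 by lra; ring. }
assert (HU : 2 * (arc_bound q w b - arc_bound q w a) / d
   <= 2 * C0 / k2 * Rpower m (e + (1 + s) / alpha)).
{ unfold Rdiv at 1; rewrite Rpower_plus; unfold d.
  rewrite Rpower_Ropp; set (P := Rpower m ((1 + s) / alpha)).
  assert (HP : 0 < P) by apply Rpower_pos.
  replace (2 * C0 / k2 * (Rpower m e * P)) with (2 * (C0 * Rpower m e) * / (k2 * / P)) by (field; lra).
  apply Rmult_le_compat_r; [|lra].
  apply Rlt_le, Rinv_0_lt_compat, Rmult_lt_0_compat; [easy | now apply Rinv_0_lt_compat]. }
(* Absorbs the additive 1 of the count into the power of [M]. *)
assert (H1 : 1 <= Rpower m (e + (1 + s) / alpha)).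
{ apply Rpower_ge_1; [|easy].
  assert (0 < (1 + s) / alpha) by (apply Rdiv_lt_0_compat; lra); lra. }
apply Rmult_le_reg_l with (1 := Hk3).
replace (k3 * ((2 * C0 / k2 + 1) / k3 * Rpower m (e + (1 + s) / alpha)))
  with ((2 * C0 / k2 + 1) * Rpower m (e + (1 + s) / alpha)) by (field; lra).
rewrite <- Em; lra.
Qed.

End Counting.

(** * Folding and winding *)

Lemma clamp_continuous (a b x : R) : continuity_pt (fun t => Rmax a (Rmin b t)) x.
Proof.
intros e He; exists e; split; [easy|].
intros t [_ Ht]; change (Rabs (t - x) < e) in Ht.
change (Rabs (Rmax a (Rmin b t) - Rmax a (Rmin b x)) < e).
apply Rle_lt_trans with (2 := Ht).
unfold Rmax, Rmin, Rabs; repeat destruct Rle_dec; repeat destruct Rcase_abs; lra.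
Qed.

(** If [x] retraces on [[m, b]] its values on [[a, m]], then moving the pair
    [(t, psi t)] with [x (psi t) = x t] from [(m, m)] to [(a, b)] changes
    [G t - G (psi t)] continuously from [0] to [G a - G b]. *)
Lemma folded_path (x G : R -> R) (a m b D : R) :
  a <= m <= b -> 0 < D ->
  (forall t, a <= t <= b -> continuity_pt x t) ->
  (forall t, a <= t <= b -> continuity_pt G t) ->
  x a = x b ->
  (forall t, a <= t <= m -> x b <= x t <= x m) ->
  (forall t t', m <= t < t' -> t' <= b -> x t' < x t) ->
  (forall t t', a <= t <= b -> a <= t' <= b -> x t = x t' -> Rabs (G t - G t') <> D) ->
  Rabs (G a - G b) < D.
Proof.
intros Hm HD Cx CG Eab Hup Hdown Hne.
(* Clamping to [[a, m]] makes the partner [psi] a function on the whole line, so continuity can be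
   used at every real point. *)
set (cl := fun t => Rmax a (Rmin m t)).
assert (Hcl : forall t, a <= cl t <= m).
{ intros t; unfold cl, Rmax, Rmin; repeat destruct Rle_dec; lra. }
assert (Hcl1 : forall t, a <= t <= m -> cl t = t).
{ intros t Ht; unfold cl, Rmax, Rmin; repeat destruct Rle_dec; lra. }
assert (Hex : forall t, exists v, m <= v <= b /\ x v = x (cl t)).
{ intros t; apply IVT_closed_dec; [lra | intros v Hv; apply Cx; lra | now apply Hup]. }
set (psi := fun t => proj1_sig (constructive_indefinite_description _ (Hex t))).
assert (Hpsi : forall t, m <= psi t <= b /\ x (psi t) = x (cl t))
  by (intros t; exact (proj2_sig (constructive_indefinite_description _ (Hex t)))).
clearbody psi; clear Hex.
assert (Hdec : forall u v, m <= u <= b -> m <= v <= b -> x v < x u -> u < v).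
{ intros u v Hu Hv Hx; apply Rnot_le_lt; intros [L|L].
  - generalize (Hdown v u ltac:(lra) ltac:(lra)); lra.
  - rewrite L in Hx; lra. }
assert (Hinj : forall u v, m <= u <= b -> m <= v <= b -> x u = x v -> u = v).
{ intros u v Hu Hv Hx; destruct (Rtotal_order u v) as [L|[L|L]]; [|easy|].
  - generalize (Hdown u v ltac:(lra) ltac:(lra)); lra.
  - generalize (Hdown v u ltac:(lra) ltac:(lra)); lra. }
assert (Ccl : forall h t, (forall t, a <= t <= b -> continuity_pt h t) ->
  continuity_pt (fun t => h (cl t)) t).
{ intros h t Ch; apply (continuity_pt_comp cl h); [apply clamp_continuous|].
  apply Ch; generalize (Hcl t); lra. }
(* [psi] inverts the strictly decreasing branch of [x]: comparing [x (cl t)] with the value of [x]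
   at a point [v] next to [psi t] bounds [psi]. At an end of [[m, b]] one side is automatic. *)
assert (Cpsi : forall t, continuity_pt psi t).
{ intros t; destruct (Hpsi t) as [Hb Ex].
  apply continuity_pt_of_locally; intros e He.
  - destruct (Rle_lt_dec b (psi t)) as [L|L].
    { exists 1; split; [lra|]; intros t' _; generalize (proj1 (Hpsi t')); lra. }
    set (v := Rmin b (psi t + e)).
    assert (Hv : psi t < v /\ v <= b /\ v <= psi t + e) by (unfold v, Rmin; destruct Rle_dec; lra).
    destruct (continuity_pt_locally_gt _ t (x v) (Ccl x t Cx)) as [d [Hd H]].
    { rewrite <- Ex; apply Hdown; lra. }
    exists d; split; [easy|]; intros t' Ht'; specialize (H t' Ht').
    destruct (Hpsi t') as [Hb' Ex']; rewrite <- Ex' in H.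
    apply Rlt_le_trans with v; [|lra]; apply Hdec; lra.
  - destruct (Rle_lt_dec (psi t) m) as [L|L].
    { exists 1; split; [lra|]; intros t' _; generalize (proj1 (Hpsi t')); lra. }
    set (v := Rmax m (psi t - e)).
    assert (Hv : v < psi t /\ m <= v /\ psi t - e <= v) by (unfold v, Rmax; destruct Rle_dec; lra).
    destruct (continuity_pt_locally_lt _ t (x v) (Ccl x t Cx)) as [d [Hd H]].
    { rewrite <- Ex; apply Hdown; lra. }
    exists d; split; [easy|]; intros t' Ht'; specialize (H t' Ht').
    destruct (Hpsi t') as [Hb' Ex']; rewrite <- Ex' in H.
    apply Rle_lt_trans with v; [lra|]; apply Hdec; lra. }
set (H := fun t => Rabs (G (cl t) - G (psi t))).
assert (CH : forall t, continuity_pt H t).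
{ intros t; apply (continuity_pt_comp (fun t => G (cl t) - G (psi t)) Rabs); [|apply Rcontinuity_abs].
  apply (continuity_pt_minus (fun t => G (cl t)) (fun t => G (psi t))); [now apply Ccl|].
  apply (continuity_pt_comp psi G); [easy|]; apply CG; generalize (proj1 (Hpsi t)); lra. }
assert (Em : psi m = m).
{ apply Hinj; [apply Hpsi | lra | rewrite (proj2 (Hpsi m)), Hcl1; lra]. }
assert (Ea : psi a = b).
{ apply Hinj; [apply Hpsi | lra | rewrite (proj2 (Hpsi a)), Hcl1; lra]. }
apply Rnot_le_lt; intros Hge.
destruct (IVT_closed_dec H a m D) as [t [Ht E]]; [lra | intros; apply CH | |].
- unfold H; rewrite Em, Ea, 2!Hcl1, Rminus_diag, Rabs_R0 by lra; lra.
- destruct (Hpsi t) as [Hb Ex]; revert E; apply Hne; [| |now symmetry].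
  + generalize (Hcl t); lra.
  + lra.
Qed.

(** The derivative is [t ^ - p * V t]. On the first quarter [V] decreases strictly from 1 to a
    negative value, since [p / t ^ 2 < 1]; on the second quarter the cosine makes it negative. The
    peak [m] is the zero of [V]. *)
Lemma damped_sine_unimodal (p tau : R) :
  0 < p <= 1 -> 1 < tau ->
  let h := fun t => Rpower t (- p) * sin (t - tau) in
  exists m, tau <= m <= tau + PI /\
    (forall t, tau <= t <= m -> 0 <= h t <= h m) /\
    (forall t t', m <= t < t' -> t' <= tau + PI -> h t' < h t).
Proof.
intros Hp Htau h.
assert (HPI := PI_RGT_0).
set (V := fun t => cos (t - tau) - p / t * sin (t - tau)).
assert (Dh : forall t, 0 < t -> is_derive h t (Rpower t (- p) * V t)).
{ intros t Ht; unfold h, V.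
  replace (Rpower t (- p) * _) with
    (- p * Rpower t (- p - 1) * sin (t - tau) + Rpower t (- p) * cos (t - tau)).
  - apply (is_derive_mult (fun t => Rpower t (- p)) (fun t => sin (t - tau)) t).
    + now apply is_derive_Rpower.
    + auto_derive; [easy | unfold Rminus; ring].
    + intros; apply Rmult_comm.
  - replace (Rpower t (- p - 1)) with (Rpower t (- p) * / t); [field; lra|].
    unfold Rminus; rewrite Rpower_plus, (Rpower_Ropp t 1), Rpower_1 by easy; ring. }
assert (DV : forall t, 0 < t ->
  is_derive V t (- sin (t - tau) * (1 - p / t ^ 2) - p / t * cos (t - tau))).
{ intros t Ht; unfold V; auto_derive; [lra | unfold Rminus; field; lra]. }
assert (CV : forall t, 0 < t -> continuity_pt V t).
{ intros t Ht; apply continuity_pt_filterlim, (ex_derive_continuous V); eexists; now apply DV. }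
assert (HVdec : forall t t', tau <= t < t' -> t' <= tau + PI / 2 -> V t' < V t).
{ intros t t' Ht Ht'.
  destruct (MVT_cor2 V (fun t => - sin (t - tau) * (1 - p / t ^ 2) - p / t * cos (t - tau)) t t')
    as [y [Ey Hy]]; [lra | intros y Hy; apply is_derive_Reals, DV; lra|].
  assert (Hs : 0 < sin (y - tau)) by (apply sin_gt_0; lra).
  assert (Hc : 0 < cos (y - tau)) by (apply cos_gt_0; lra).
  assert (Hq : p / y ^ 2 < 1).
  { apply Rmult_lt_reg_r with (y ^ 2); [nra|]; unfold Rdiv; rewrite Rmult_assoc, Rinv_l; nra. }
  assert (Hq' : 0 < p / y) by (apply Rdiv_lt_0_compat; lra).
  assert (H1 : 0 < sin (y - tau) * (1 - p / y ^ 2)) by (apply Rmult_lt_0_compat; lra).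
  assert (H2 : 0 < p / y * cos (y - tau)) by (apply Rmult_lt_0_compat; lra).
  nra. }
destruct (IVT_closed_dec V tau (tau + PI / 2) 0) as [m [Hm Em]].
- lra.
- intros t Ht; apply CV; lra.
- unfold V; rewrite Rminus_diag, cos_0, sin_0.
  replace (tau + PI / 2 - tau) with (PI / 2) by ring; rewrite cos_PI2, sin_PI2.
  assert (0 < p / (tau + PI / 2)) by (apply Rdiv_lt_0_compat; lra); lra.
- exists m; split; [lra|]; split.
  + intros t Ht; split.
    * apply Rmult_le_pos; [apply Rlt_le, Rpower_pos | apply sin_ge_0; lra].
    * apply (derive_nonneg_incr h (fun t => Rpower t (- p) * V t)); [lra | intros; apply Dh; lra|].
      intros y Hy; apply Rmult_le_pos; [apply Rlt_le, Rpower_pos|].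
      destruct (Req_dec y m) as [E|E]; [rewrite E, Em; lra|].
      generalize (HVdec y m ltac:(lra) ltac:(lra)); lra.
  + intros t t' Ht Ht'.
    destruct (MVT_cor2 h (fun t => Rpower t (- p) * V t) t t') as [y [Ey Hy]];
      [lra | intros y Hy; apply is_derive_Reals, Dh; lra|].
    assert (HV : V y < 0).
    { destruct (Rle_lt_dec y (tau + PI / 2)) as [L|L].
      - generalize (HVdec m y ltac:(lra) L); lra.
      - unfold V; assert (cos (y - tau) < 0) by (apply cos_lt_0; lra).
        assert (0 <= sin (y - tau)) by (apply sin_ge_0; lra).
        assert (0 < p / y) by (apply Rdiv_lt_0_compat; lra).
        assert (0 <= p / y * sin (y - tau)) by (apply Rmult_le_pos; lra); lra. }
    assert (HP := Rpower_pos y (- p)).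
    assert (0 < Rpower y (- p) * - V y) by (apply Rmult_lt_0_compat; lra); nra.
Qed.

(** * Opposite points and quadrants *)

(** With both products non-positive, the cross terms only increase the squared distance, which is
    thus at least the squared norm of the first point. *)
Lemma spiral_dist_opposite (p q u v B : R) :
  0 < q -> p <= q -> 1 <= u <= B -> cos u * cos v <= 0 -> sin u * sin v <= 0 ->
  Rpower B (- q) <= Cmod (spiral p q u - spiral p q v)%C.
Proof.
intros Hq Hpq Hu Hc Hs.
apply Rle_trans with (Rpower u (- q)); [apply Rpower_neg_le_l; lra|].
apply Cmod_ge; [apply Rlt_le, Rpower_pos|].
change (fst (spiral p q u - spiral p q v)%C) with (Rpower u (- p) * cos u - Rpower v (- p) * cos v).
change (snd (spiral p q u - spiral p q v)%C) with (Rpower u (- q) * sin u - Rpower v (- q) * sin v).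
assert (H : Rpower u (- q) <= Rpower u (- p)) by (apply Rle_Rpower; lra).
assert (H1 := sin2_cos2 u); rewrite 2!Rsqr_pow2 in H1.
generalize (Rpower_pos u (- p)) (Rpower_pos u (- q)) (Rpower_pos v (- p)) (Rpower_pos v (- q)).
revert H; generalize (Rpower u (- p)) (Rpower u (- q)) (Rpower v (- p)) (Rpower v (- q)).
intros A B0 A' B' HAB HA HB HA' HB'.
assert (H2 : 0 <= A * A' * - (cos u * cos v)) by (apply Rmult_le_pos; nra).
assert (H3 : 0 <= B0 * B' * - (sin u * sin v)) by (apply Rmult_le_pos; nra).
assert (H4 : B0 ^ 2 <= A ^ 2) by (apply pow_incr; lra).
assert (H5 := pow2_ge_0 (A' * cos v)); assert (H6 := pow2_ge_0 (B' * sin v)).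
assert (H7 : B0 ^ 2 * cos u ^ 2 <= A ^ 2 * cos u ^ 2) by (apply Rmult_le_compat_r; [apply pow2_ge_0 | easy]).
replace (B0 ^ 2) with (B0 ^ 2 * sin u ^ 2 + B0 ^ 2 * cos u ^ 2)
  by (rewrite <- Rmult_plus_distr_l, H1; ring).
nra.
Qed.

(** Quarter turns are counted without reduction modulo 4, so this is a discrete form of the lifted
    angle and records winding. *)
Definition quadrant (u : R) : Z := Int_part (u / (PI / 2)).

Lemma quadrant_bounds (u : R) :
  IZR (quadrant u) * (PI / 2) <= u < (IZR (quadrant u) + 1) * (PI / 2).
Proof.
assert (HPI := PI_RGT_0).
destruct (base_Int_part (u / (PI / 2))) as [H1 H2]; fold (quadrant u) in H1, H2.
assert (E : u = u / (PI / 2) * (PI / 2)) by (field; lra).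
split.
- rewrite E at 2; apply Rmult_le_compat_r; lra.
- rewrite E at 1; apply Rmult_lt_compat_r; lra.
Qed.

(** Write [u = z + a] and [v = z + PI + b] with [a] and [b] in [[0, PI / 2]], where [z] is a
    multiple of [PI / 2]. Since [sin z * cos z = 0], the mixed terms of the expansions vanish and
    the others have a fixed sign. *)
Lemma quadrant_opposite (u v : R) :
  quadrant v = (quadrant u + 2)%Z -> cos u * cos v <= 0 /\ sin u * sin v <= 0.
Proof.
intros E.
assert (HPI := PI_RGT_0).
assert (Hu := quadrant_bounds u); assert (Hv := quadrant_bounds v).
rewrite E, plus_IZR in Hv; set (k := quadrant u) in *.
set (z := IZR k * (PI / 2)) in *.
set (a := u - z); set (b := v - z - PI).
assert (Hz : sin z * cos z = 0).
{ assert (H := sin_2a z); replace (2 * z) with (IZR k * PI) in H by (unfold z; field).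
  rewrite (sin_eq_0_1 (IZR k * PI)) in H by now exists k. lra. }
assert (Ha : 0 <= a <= PI / 2) by (unfold a, z in *; lra).
assert (Hb : 0 <= b <= PI / 2) by (unfold b, z in *; lra).
replace u with (z + a) by (unfold a; ring).
replace v with (z + b + PI) by (unfold b; ring).
rewrite neg_cos, neg_sin, 2!cos_plus, 2!sin_plus.
assert (Hca : 0 <= cos a) by (apply cos_ge_0; lra).
assert (Hsa : 0 <= sin a) by (apply sin_ge_0; lra).
assert (Hcb : 0 <= cos b) by (apply cos_ge_0; lra).
assert (Hsb : 0 <= sin b) by (apply sin_ge_0; lra).
assert (Hcc := Rmult_le_pos _ _ Hca Hcb); assert (Hss := Rmult_le_pos _ _ Hsa Hsb).
assert (H1 := Rmult_le_pos _ _ (pow2_ge_0 (cos z)) Hcc).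
assert (H2 := Rmult_le_pos _ _ (pow2_ge_0 (sin z)) Hss).
assert (H3 := Rmult_le_pos _ _ (pow2_ge_0 (sin z)) Hcc).
assert (H4 := Rmult_le_pos _ _ (pow2_ge_0 (cos z)) Hss).
split.
- replace (_ * _) with (- (cos z ^ 2 * (cos a * cos b)) - sin z ^ 2 * (sin a * sin b)
    + (sin z * cos z) * (cos a * sin b + sin a * cos b)) by ring.
  rewrite Hz; lra.
- replace (_ * _) with (- (sin z ^ 2 * (cos a * cos b)) - cos z ^ 2 * (sin a * sin b)
    - (sin z * cos z) * (cos a * sin b + sin a * cos b)) by ring.
  rewrite Hz; lra.
Qed.

Lemma quadrant_diff (u v : R) :
  Rabs (u - v) < PI -> (-2 <= quadrant u - quadrant v <= 2)%Z.
Proof.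
intros H; apply Rabs_def2 in H.
assert (HPI := PI_RGT_0).
assert (Hu := quadrant_bounds u); assert (Hv := quadrant_bounds v).
assert (H1 : IZR (quadrant u - quadrant v) < 3) by (rewrite minus_IZR; nra).
assert (H2 : -3 < IZR (quadrant u - quadrant v)) by (rewrite minus_IZR; nra).
apply lt_IZR in H1; apply lt_IZR in H2; lia.
Qed.

(** Indices differing by 2 denote opposite quadrants, where points are at least [B ^ - q] apart. *)
Lemma quadrant_close (p q u v B : R) :
  0 < q -> p <= q -> 1 <= u <= B -> 1 <= v <= B ->
  Cmod (spiral p q u - spiral p q v)%C < Rpower B (- q) ->
  (quadrant u - quadrant v <> 2 /\ quadrant u - quadrant v <> -2)%Z.
Proof.
intros Hq Hpq Hu Hv Hlt; split; intros E.
- destruct (quadrant_opposite v u) as [H1 H2]; [lia|].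
  generalize (spiral_dist_opposite p q u v B Hq Hpq Hu); lra.
- destruct (quadrant_opposite u v) as [H1 H2]; [lia|].
  generalize (spiral_dist_opposite p q u v B Hq Hpq Hu); lra.
Qed.

Lemma spiral_inj (p q u v : R) : 0 < p -> 0 < q -> 0 < u -> 0 < v ->
  spiral p q u = spiral p q v -> u = v.
Proof.
intros Hp Hq Hu Hv E.
assert (H0 : ellipse_level p q v (spiral p q v) = 1).
{ rewrite ellipse_level_spiral by easy; unfold Rdiv; rewrite Rinv_r, 2!Rpower_1_l by lra.
  generalize (sin2_cos2 v); rewrite 2!Rsqr_pow2; lra. }
destruct (Rtotal_order u v) as [L|[L|L]]; [|easy|]; rewrite <- E in H0.
- generalize (ellipse_level_gt p q u v Hp Hq); lra.
- generalize (ellipse_level_lt p q u v Hp Hq); lra.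
Qed.

(** * Maps between spirals *)

(** Serves the choice of thresholds [T = K * M ^ (y / a)]: the power turns [T ^ - a] into [M ^ - y],
    and [K] absorbs the constants uniformly in [M]. *)
Lemma Rpower_neg_scale (K a m y C eps t : R) :
  0 < a -> 0 < K -> 1 <= m -> 0 < C -> C * Rpower K (- a) < eps ->
  K * Rpower m (y / a) <= t -> C * Rpower t (- a) < eps * Rpower m (- y).
Proof.
intros Ha HK Hm HC He Ht.
assert (Hp := Rpower_pos m (y / a)).
apply Rle_lt_trans with (C * Rpower (K * Rpower m (y / a)) (- a)).
- apply Rmult_le_compat_l; [lra|]; apply Rpower_neg_le_l; [lra|].
  split; [now apply Rmult_lt_0_compat | easy].
- rewrite <- Rpower_mult_distr, Rpower_mult by easy.
  replace (y / a * - a) with (- y) by (field; lra).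
  rewrite <- Rmult_assoc; apply Rmult_lt_compat_r; [apply Rpower_pos | easy].
Qed.

Lemma Rpower_scal_neg (b t e alpha : R) :
  0 < b -> Rpower (b * Rpower t (- e)) alpha = Rpower b alpha * Rpower t (- (e * alpha)).
Proof.
intros Hb; rewrite <- Rpower_mult_distr, Rpower_mult by (try easy; apply Rpower_pos).
do 2 f_equal; ring.
Qed.

Lemma arc_bound_scale (q w a b K m x : R) :
  0 < q -> 0 < w -> 0 < K -> 0 < m -> 0 < b <= K * Rpower m x ->
  arc_bound q w b - arc_bound q w a <= (q + 1) / w * Rpower K w * Rpower m (x * w).
Proof.
intros Hq Hw HK Hm Hb.
assert (Hqw : 0 < (q + 1) / w) by (apply Rdiv_lt_0_compat; lra).
assert (Ha : 0 < arc_bound q w a) by (apply Rmult_lt_0_compat; [easy | apply Rpower_pos]).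
assert (H : arc_bound q w b <= (q + 1) / w * (Rpower K w * Rpower m (x * w))).
{ apply Rmult_le_compat_l; [lra|].
  rewrite <- (Rpower_mult m), Rpower_mult_distr by (try easy; apply Rpower_pos).
  apply Rle_Rpower_l; lra. }
lra.
Qed.

Lemma arc_bound_step (q w a b : R) :
  0 < q -> 0 < w <= 1 -> 1 <= a <= b ->
  arc_bound q w b - arc_bound q w a <= (q + 1) * (b - a).
Proof.
intros Hq Hw Hab.
destruct (MVT_gen (arc_bound q w) a b (fun t => (q + 1) * Rpower t (w - 1))) as [x [Hx E]].
- rewrite Rmin_left, Rmax_right by lra; intros x Hx; apply arc_bound_derive; lra.
- rewrite Rmin_left, Rmax_right by lra; intros x Hx.
  apply continuity_pt_filterlim, (ex_derive_continuous (arc_bound q w)).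
  eexists; apply arc_bound_derive; lra.
- rewrite Rmin_left, Rmax_right in Hx by lra; rewrite E.
  apply Rmult_le_compat_r; [lra|].
  rewrite <- (Rmult_1_r (q + 1)) at 2; apply Rmult_le_compat_l; [lra|].
  replace (w - 1) with (- (1 - w)) by ring; apply Rpower_neg_le_1; lra.
Qed.

Section SpiralMap.

Variables (p q r s alpha c w : R) (f : C -> C) (g : R -> R).
Hypotheses (hp : 0 < p) (hpq : p <= q) (hr : 0 < r) (hrs : r <= s) (hp1 : p <= 1).
Hypotheses (halpha : 0 < alpha) (hc : 0 < c) (hw : 0 < w) (hw1 : w <= 1) (hpw : 1 - p <= w).
Hypothesis hf : forall x y d, elliptical_spiral p q x -> elliptical_spiral p q y ->
  0 < d -> Cmod (x - y)%C <= d -> Cmod (f x - f y)%C <= c * Rpower d alpha.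
Hypothesis hg1 : forall t, 1 < g t.
Hypothesis hg : forall t, 1 < t -> f (spiral p q t) = spiral r s (g t).
Hypothesis hsurj : forall u, 1 < u -> exists t, 1 < t /\ f (spiral p q t) = spiral r s u.

Lemma parameter_continuous (t0 : R) : 1 < t0 -> continuity_pt g t0.
Proof.
intros Ht0.
assert (Hlim : forall e, 0 < e -> exists d, 0 < d /\ forall t, Rabs (t - t0) < d ->
  1 < t /\ Cmod (f (spiral p q t) - f (spiral p q t0))%C < e).
{ intros e He.
  set (rho := Rpower (e / (2 * c)) (/ alpha)).
  assert (Hrho : 0 < rho) by apply Rpower_pos.
  assert (Erho : c * Rpower rho alpha = e / 2).
  { unfold rho; rewrite Rpower_mult, Rinv_l, Rpower_1 by (try lra; apply Rdiv_lt_0_compat; lra).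
    field; lra. }
  destruct (spiral_continuous p q t0) as [C1 C2]; [lra|].
  destruct (C1 (rho / 2)) as [d1 [Hd1 H1]]; [lra|].
  destruct (C2 (rho / 2)) as [d2 [Hd2 H2]]; [lra|].
  exists (Rmin (t0 - 1) (Rmin d1 d2)); split; [repeat apply Rmin_pos; lra|].
  intros t Ht.
  assert (L0 := Rlt_le_trans _ _ _ Ht (Rmin_l _ _)).
  assert (L1 := Rlt_le_trans _ _ _ Ht (Rle_trans _ _ _ (Rmin_r _ _) (Rmin_l _ _))).
  assert (L2 := Rlt_le_trans _ _ _ Ht (Rle_trans _ _ _ (Rmin_r _ _) (Rmin_r _ _))).
  assert (Ht1 : 1 < t) by (apply Rabs_def2 in L0; lra).
  split; [easy|]; apply Rle_lt_trans with (c * Rpower rho alpha); [|lra].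
  apply hf; [now apply spiral_in | now apply spiral_in | easy|].
  destruct (Req_dec t t0) as [E|E].
  { rewrite E; replace (spiral p q t0 - spiral p q t0)%C with (RtoC 0) by ring.
    rewrite Cmod_0; lra. }
  specialize (H1 t (conj (conj I (not_eq_sym E)) L1)).
  specialize (H2 t (conj (conj I (not_eq_sym E)) L2)).
  change (Rabs (fst (spiral p q t) - fst (spiral p q t0)) < rho / 2) in H1.
  change (Rabs (snd (spiral p q t) - snd (spiral p q t0)) < rho / 2) in H2.
  apply Rle_trans with (1 := Cmod_le_abs _).
  change (Rabs (fst (spiral p q t) - fst (spiral p q t0))
    + Rabs (snd (spiral p q t) - snd (spiral p q t0)) <= rho); lra. }
apply (spiral_parameter_continuous r s (fun t => f (spiral p q t))); try easy; try lra.
- exists (t0 - 1); split; [lra|]; intros t Ht; apply hg; apply Rabs_def2 in Ht; lra.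
- intros e He; destruct (Hlim e He) as [d [Hd H]]; exists d; split; [easy|]; intros t [_ Ht].
  apply Rle_lt_trans with (2 := proj2 (H t Ht)).
  exact (fst_Cmod (f (spiral p q t) - f (spiral p q t0))%C).
- intros e He; destruct (Hlim e He) as [d [Hd H]]; exists d; split; [easy|]; intros t [_ Ht].
  apply Rle_lt_trans with (2 := proj2 (H t Ht)).
  exact (snd_Cmod (f (spiral p q t) - f (spiral p q t0))%C).
Qed.

(** If [g] is unbounded on every tail, each [t] has a later [t'] whose image is arbitrarily close to
    0. The source points at [t] and [t'] have norm at most [2 * t ^ - p], so the Hölder bound at
    distance [4 * t ^ - p] applies. *)
Lemma tail_bounded_or_decay :
  (exists T B, 1 < T /\ forall t, T <= t -> g t <= B) \/
  (forall t, 1 < t -> Cmod (f (spiral p q t)) <= c * Rpower 4 alpha * Rpower t (- (p * alpha))).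
Proof.
destruct (classic (exists T B, 1 < T /\ forall t, T <= t -> g t <= B)) as [H|H]; [now left|right].
intros t Ht; apply le_epsilon; intros e He.
destruct (Rpower_neg_small 2 r e) as [B [HB1 HB]]; try lra.
assert (Ht' : exists t', t <= t' /\ B < g t').
{ apply NNPP; intros Hn; apply H; exists t, B; split; [easy|]; intros t' Ht'.
  apply Rnot_lt_le; intros L; apply Hn; now exists t'. }
destruct Ht' as [t' [Htt' Hg']].
assert (H1 : Cmod (spiral r s (g t')) < e).
{ apply Rle_lt_trans with (1 := spiral_norm_le r s (g t') hrs (Rlt_le _ _ (hg1 t'))); apply HB; lra. }
assert (H2 : Cmod (spiral p q t - spiral p q t')%C <= 4 * Rpower t (- p)).
{ assert (Hm : Rpower t' (- p) <= Rpower t (- p)) by (apply Rpower_neg_le_l; lra).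
  assert (Hn1 := spiral_norm_le p q t hpq (Rlt_le _ _ Ht)).
  assert (Hn2 := spiral_norm_le p q t' hpq ltac:(lra)).
  apply Rle_trans with (1 := Cmod_triangle _ _); rewrite Cmod_opp; lra. }
assert (HP := Rpower_pos t (- p)).
apply (hf _ _ (4 * Rpower t (- p)) (spiral_in p q t Ht) (spiral_in p q t' ltac:(lra)) ltac:(lra)) in H2.
rewrite Rpower_scal_neg, (hg t') in H2 by lra.
replace (f (spiral p q t)) with (f (spiral p q t) - spiral r s (g t') + spiral r s (g t'))%C by ring.
apply Rle_trans with (1 := Cmod_triangle _ _); lra.
Qed.

(** Parameters above [B] are attained only before [T], so the fixed arc from 1 to [T] covers all
    inner turns. Its length does not grow with [M], which allows any [e >= 0]. *)
Lemma tail_bounded_exponent (T B e : R) :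
  1 < T -> (forall t, T <= t -> g t <= B) -> 0 <= e -> 2 + s - r <= e + (1 + s) / alpha.
Proof.
intros HT HB He.
assert (HPI2 := PI2_1).
destruct (nfloor_ex (Rmax B 1)) as [n Hn]; [generalize (Rmax_r B 1); lra|].
assert (Hmono : 0 <= arc_bound q w T - arc_bound q w 1).
{ assert (arc_bound q w 1 <= arc_bound q w T) by (apply arc_bound_incr; lra); lra. }
apply (covered_turns_exponent p q r s alpha c w f hp hpq hr hrs halpha hc hw hpw hf
  (arc_bound q w T - arc_bound q w 1) e (n + 1)); [easy | easy|].
intros M HM HM1; exists M, 1, T; split; [lia|]; split; [lra|]; split.
- intros u [Hu _].
  assert (HMR : INR n + 1 <= INR M) by (rewrite <- S_INR; apply le_INR; lia).
  assert (H := pos_INR n).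
  assert (Hu' : INR M < u) by nra.
  generalize (Rmax_l B 1) (Rmax_r B 1); intros HB1 HB2.
  destruct (hsurj u) as [t [Ht E]]; [lra|].
  exists t; split; [easy|]; split; [|easy]; split; [lra|].
  apply Rnot_lt_le; intros L; specialize (HB t (Rlt_le _ _ L)).
  rewrite hg in E by easy; apply spiral_inj in E; try lra; generalize (hg1 t); lra.
- assert (HMR : 1 <= INR M) by now apply (le_INR 1).
  generalize (Rpower_ge_1 (INR M) e He HMR); nra.
Qed.

Hypothesis hdecay :
  forall t, 1 < t -> Cmod (f (spiral p q t)) <= c * Rpower 4 alpha * Rpower t (- (p * alpha)).

(** A point with parameter at most [B] has norm at least [B ^ - s], which the decay eventually
    excludes. *)
Lemma parameter_large (B : R) : 1 < B -> exists t0, 1 < t0 /\ forall t, t0 <= t -> B < g t.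
Proof.
intros HB.
destruct (Rpower_neg_small (c * Rpower 4 alpha) (p * alpha) (Rpower B (- s))) as [t0 [H1 H]].
- apply Rmult_lt_0_compat; [easy | apply Rpower_pos].
- now apply Rmult_lt_0_compat.
- apply Rpower_pos.
- exists t0; split; [easy|]; intros t Ht; specialize (H t Ht).
  apply Rnot_le_lt; intros L.
  assert (Hd := hdecay t ltac:(lra)); rewrite hg in Hd by lra.
  assert (Hn := spiral_norm_ge r s (g t) hrs (Rlt_le _ _ (hg1 t))).
  assert (Rpower B (- s) <= Rpower (g t) (- s)) by (apply Rpower_neg_le_l; [lra | generalize (hg1 t); lra]).
  lra.
Qed.

Lemma parameter_IVT (a b u : R) : 1 < a <= b -> g a <= u <= g b ->
  exists t, a <= t <= b /\ g t = u.
Proof.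
intros Ha Hu; apply IVT_closed; [lra | intros t Ht; apply parameter_continuous; lra | easy].
Qed.

Lemma covers_of_endpoints (N M : nat) (a b : R) : 1 < a <= b ->
  g a <= 2 * PI * INR N -> 2 * PI * INR (N + M) <= g b -> covers_turns p q r s f N M a b.
Proof.
intros Hab H1 H2 u Hu.
destruct (parameter_IVT a b u Hab ltac:(lra)) as [t [Ht E]].
exists t; split; [lra|]; split; [easy|]; rewrite <- E; apply hg; lra.
Qed.

(** The spiral [S_(r,s)] crosses the long axis at distance [u ^ - r], so once
    [f] maps the tail closer to the origin, no further full turn can begin. *)
Lemma long_axis_exponent : 2 + s - r <= r / p / alpha * w + (1 + s) / alpha.
Proof.
assert (HPI := PI2_1).
assert (Hpa : 0 < p * alpha) by now apply Rmult_lt_0_compat.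
assert (HC : 0 < c * Rpower 4 alpha) by (apply Rmult_lt_0_compat; [easy | apply Rpower_pos]).
(* Beyond [T], images are to be closer to 0 than the point at parameter [4 * PI * M], the end of
   turns [M] to [2 * M]. Adding 1 to [K0] ensures [2 <= T]. *)
destruct (Rpower_neg_small (c * Rpower 4 alpha) (p * alpha) (Rpower (4 * PI) (- r)) HC Hpa
  (Rpower_pos _ _)) as [K0 [HK0 HK]].
set (K := K0 + 1); specialize (HK K ltac:(unfold K; lra)).
assert (HK2 : 2 <= K) by (unfold K; lra).
assert (Hx : 0 <= r / p / alpha) by (apply Rlt_le; repeat apply Rdiv_lt_0_compat; lra).
assert (Hqw : 0 < (q + 1) / w) by (apply Rdiv_lt_0_compat; lra).
destruct (nfloor_ex (g 2)) as [n Hn]; [generalize (hg1 2); lra|].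
apply (covered_turns_exponent p q r s alpha c w f hp hpq hr hrs halpha hc hw hpw hf
  ((q + 1) / w * Rpower K w) _ (n + 1)).
{ apply Rlt_le, Rmult_lt_0_compat; [easy | apply Rpower_pos]. }
{ apply Rmult_le_pos; lra. }
intros M HM HM1.
assert (HMR : INR n + 1 <= INR M) by (rewrite <- S_INR; apply le_INR; lia).
assert (Hn0 := pos_INR n).
set (T := K * Rpower (INR M) (r / p / alpha)).
assert (HT : 2 <= T).
{ assert (H1 : 1 <= Rpower (INR M) (r / p / alpha)) by (apply Rpower_ge_1; lra); unfold T; nra. }
exists M, 2, T; split; [lia|]; split; [lra|]; split.
- apply covers_of_endpoints; [lra | nra|].
  (* If [g T] fell short of [4 * PI * M], then [g], which tends to infinity, would take this value
     after [T], at a point of the long axis too far from 0. *)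
  apply Rnot_lt_le; intros L.
  destruct (parameter_large (2 * PI * INR (M + M))) as [t0 [Ht0 Hlarge]].
  { rewrite plus_INR; nra. }
  destruct (parameter_IVT T (Rmax T t0) (2 * PI * INR (M + M))) as [t [Ht E]].
  { generalize (Rmax_l T t0); lra. }
  { split; [lra | apply Rlt_le, Hlarge, Rmax_r]. }
  assert (Hd := hdecay t ltac:(lra)); rewrite hg, E in Hd by lra.
  assert (Hax := spiral_norm_axis r s (M + M)).
  assert (Hsc := Rpower_neg_scale K (p * alpha) (INR M) r (c * Rpower 4 alpha)
    (Rpower (4 * PI) (- r)) t Hpa ltac:(lra) ltac:(lra) HC HK).
  rewrite Rpower_mult_distr in Hsc by lra.
  replace (2 * PI * INR (M + M)) with (4 * PI * INR M) in Hax, Hd by (rewrite plus_INR; ring).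
  replace (r / (p * alpha)) with (r / p / alpha) in Hsc by (field; lra).
  specialize (Hsc (proj1 Ht)); lra.
- apply arc_bound_scale; fold T; lra.
Qed.

(** * Half turns between successive crossings of the short axis *)

Definition half_turn (j : nat) : R := INR j * PI + PI / 2.

Lemma cos_half_turn (j : nat) : cos (half_turn j) = 0.
Proof.
apply cos_eq_0_1; exists (Z.of_nat j); now rewrite <- INR_IZR_INZ.
Qed.

Lemma half_turn_S (j : nat) : half_turn (S j) = half_turn j + PI.
Proof. unfold half_turn; rewrite S_INR; ring. Qed.

Lemma half_turn_ge (j : nat) : 3 / 2 < half_turn j.
Proof.
unfold half_turn; generalize PI2_3_2 (pos_INR j) PI_RGT_0; intros H1 H2 H3.
generalize (Rmult_le_pos _ _ H2 (Rlt_le _ _ H3)); lra.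
Qed.

(** Points on a common vertical line differ only in their ordinates, which are at most [T ^ - q] in
    absolute value. *)
Lemma images_close (t t' T : R) :
  1 < T -> T <= t -> T <= t' -> fst (spiral p q t) = fst (spiral p q t') ->
  Cmod (spiral r s (g t) - spiral r s (g t'))%C
    <= c * Rpower 2 alpha * Rpower T (- (q * alpha)).
Proof.
intros HT Ht Ht' E.
rewrite <- 2!hg by lra.
rewrite Rmult_assoc, <- Rpower_scal_neg by lra.
apply hf; [apply spiral_in; lra | apply spiral_in; lra | |].
{ apply Rmult_lt_0_compat; [lra | apply Rpower_pos]. }
apply Rle_trans with (1 := Cmod_le_abs _).
change (Rabs (fst (spiral p q t) - fst (spiral p q t'))
  + Rabs (snd (spiral p q t) - snd (spiral p q t')) <= 2 * Rpower T (- q)).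
rewrite E, Rminus_diag, Rabs_R0, Rplus_0_l.
cbn [spiral snd].
assert (H1 := Rabs_mul_sin_le (Rpower t (- q)) t (Rlt_le _ _ (Rpower_pos _ _))).
assert (H2 := Rabs_mul_sin_le (Rpower t' (- q)) t' (Rlt_le _ _ (Rpower_pos _ _))).
assert (H3 : Rpower t (- q) <= Rpower T (- q)) by (apply Rpower_neg_le_l; lra).
assert (H4 : Rpower t' (- q) <= Rpower T (- q)) by (apply Rpower_neg_le_l; lra).
apply Rle_trans with (1 := Rabs_triang _ _); rewrite Rabs_Ropp; lra.
Qed.

(** Along the half turn the abscissa is a constant multiple of a damped sine, so [folded_path]
    applies with [D = PI]. Points on a common vertical line have close images; parameters differing
    by exactly [PI] would put these images on opposite sides of the origin. *)
Lemma half_turn_fold (j : nat) (B T : R) :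
  1 < T <= half_turn j -> c * Rpower 2 alpha * Rpower T (- (q * alpha)) < Rpower B (- s) ->
  (forall t, half_turn j <= t <= half_turn (S j) -> g t <= B) ->
  Rabs (g (half_turn j) - g (half_turn (S j))) < PI.
Proof.
intros HT HB Hg.
assert (HPI := PI_RGT_0).
rewrite half_turn_S in *.
set (tau := half_turn j) in *.
destruct (damped_sine_unimodal p tau) as [m [Hm [Hup Hdown]]]; [lra | lra|].
set (h := fun t => Rpower t (- p) * sin (t - tau)).
assert (Ea : h tau = 0) by (unfold h; rewrite Rminus_diag, sin_0; ring).
assert (Eb : h (tau + PI) = 0).
{ unfold h; replace (tau + PI - tau) with PI by ring; rewrite sin_PI; ring. }
assert (Efst : forall t, fst (spiral p q t) = - sin tau * h t).
{ intros t; cbn [spiral fst]; unfold h.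
  replace (cos t) with (cos (t - tau + tau)) by (f_equal; ring).
  rewrite cos_plus; unfold tau at 2; rewrite cos_half_turn; fold tau; ring. }
apply (folded_path h g tau m (tau + PI) PI Hm HPI).
- intros t Ht; apply (continuity_pt_mult (fun t => Rpower t (- p)) (fun t => sin (t - tau))).
  + apply continuity_pt_Rpower; lra.
  + apply (continuity_pt_comp (fun t => t - tau) sin); [|apply continuity_sin].
    apply continuity_pt_minus; [apply derivable_continuous_pt, derivable_pt_id|].
    apply continuity_pt_const; now intros ? ?.
- intros t Ht; apply parameter_continuous; lra.
- now rewrite Ea, Eb.
- intros t Ht; rewrite Eb; now apply Hup.
- exact Hdown.
- intros t t' Ht Ht' E EPI.
  assert (Hclose := images_close t t' T ltac:(lra) ltac:(lra) ltac:(lra)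
    ltac:(now rewrite 2!Efst, E)).
  assert (Hopp : cos (g t') = - cos (g t) /\ sin (g t') = - sin (g t)).
  { revert EPI; unfold Rabs; destruct Rcase_abs; intros EPI.
    - replace (g t') with (g t + PI) by lra; now rewrite neg_cos, neg_sin.
    - replace (g t) with (g t' + PI) by lra; rewrite neg_cos, neg_sin; lra. }
  destruct Hopp as [E1 E2].
  assert (Hfar := spiral_dist_opposite r s (g t) (g t') B ltac:(lra) hrs
    (conj (Rlt_le _ _ (hg1 t)) (Hg t Ht))).
  rewrite E1, E2 in Hfar.
  generalize (pow2_ge_0 (cos (g t))) (pow2_ge_0 (sin (g t))); intros.
  specialize (Hfar ltac:(nra) ltac:(nra)); lra.
Qed.

(** All crossings lie on one vertical line, so quadrants of their images never differ by exactly 2.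
    One half turn changes the quadrant by at most 2, hence by at most 1, so the distance to the
    initial quadrant is at most 2, hence at most 1 again. There is no drift, and [g] stays below its
    initial value plus [PI]. *)
Lemma half_turn_quadrant (j0 : nat) (A B T : R) :
  1 < T <= half_turn j0 -> c * Rpower 2 alpha * Rpower T (- (q * alpha)) < Rpower B (- s) ->
  g (half_turn j0) + PI <= A -> A < B ->
  (forall j t, (j0 <= j)%nat -> half_turn j <= t <= half_turn (S j) ->
    g (half_turn j) <= A -> g t <= B) ->
  forall n, g (half_turn (j0 + n)) <= A /\
    (-1 <= quadrant (g (half_turn (j0 + n))) - quadrant (g (half_turn j0)) <= 1)%Z.
Proof.
intros HT HB HA HAB Hstep n.
assert (HPI := PI_RGT_0).
assert (Hmono : forall n, T <= half_turn (j0 + n)).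
{ intros k; unfold half_turn in *; rewrite plus_INR; generalize (pos_INR k); nra. }
assert (Hq : forall v, (quadrant v - quadrant (g (half_turn j0)) <= 1)%Z -> v <= A).
{ intros v Hv; apply Z.le_sub_le_add_r, IZR_le in Hv; rewrite plus_IZR in Hv.
  generalize (quadrant_bounds v) (quadrant_bounds (g (half_turn j0))); nra. }
induction n as [|n [IHA IHq]].
{ rewrite Nat.add_0_r; split; [lra | lia]. }
assert (Hg : forall t, half_turn (j0 + n) <= t <= half_turn (S (j0 + n)) -> g t <= B).
{ intros t Ht; apply (Hstep (j0 + n)%nat); [lia | easy | easy]. }
assert (Hfold := half_turn_fold (j0 + n) B T (conj (proj1 HT) (Hmono n)) HB Hg).
rewrite <- Nat.add_succ_r in *.
assert (Hcl : forall i k, Cmod (spiral r s (g (half_turn (j0 + i)))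
    - spiral r s (g (half_turn (j0 + k))))%C < Rpower B (- s)).
{ intros i k; apply Rle_lt_trans with (2 := HB); apply images_close; [lra | easy | easy|].
  cbn [spiral fst]; rewrite 2!cos_half_turn; ring. }
assert (Hlast : g (half_turn (j0 + S n)) <= B).
{ apply Hg; rewrite Nat.add_succ_r, half_turn_S; lra. }
assert (Hh1 := fun i => Rlt_le _ _ (hg1 (half_turn (j0 + i)))).
destruct (quadrant_close r s (g (half_turn (j0 + n))) (g (half_turn (j0 + S n))) B)
  as [N1 N2]; [lra | easy | split; [easy | lra] | now split | apply Hcl|].
assert (H2 := quadrant_diff _ _ Hfold).
destruct (quadrant_close r s (g (half_turn (j0 + S n))) (g (half_turn (j0 + 0))) B)
  as [N3 N4]; [lra | easy | now split | rewrite Nat.add_0_r; generalize (hg1 (half_turn j0)); lra | apply Hcl|].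
rewrite Nat.add_0_r in N3, N4.
assert (Hz : (-1 <= quadrant (g (half_turn (j0 + S n))) - quadrant (g (half_turn j0)) <= 1)%Z) by lia.
split; [apply Hq; lia | exact Hz].
Qed.

(** Once the two sides of a half turn of [S_(p,q)] are mapped closer to each
    other than the short axis [u ^ - s] of the target, a half turn is folded by
    [f] and its winding number around the origin vanishes, unless its image
    passes through the inner turns, which a single half turn must then cover. *)
Lemma short_axis_exponent : 2 + s - r <= s / q / alpha * w + (1 + s) / alpha.
Proof.
assert (HPI := PI2_1).
assert (Hqa : 0 < q * alpha) by (apply Rmult_lt_0_compat; lra).
assert (HC : 0 < c * Rpower 2 alpha) by (apply Rmult_lt_0_compat; [easy | apply Rpower_pos]).
destruct (Rpower_neg_small (c * Rpower 2 alpha) (q * alpha) (Rpower (14 * PI) (- s)) HC Hqa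
  (Rpower_pos _ _)) as [K0 [HK0 HK]].
set (K := K0 + 1); specialize (HK K ltac:(unfold K; lra)).
assert (HK2 : 2 <= K) by (unfold K; lra).
assert (Hx : 0 <= s / q / alpha) by (apply Rlt_le; repeat apply Rdiv_lt_0_compat; lra).
assert (Hxw : 0 <= s / q / alpha * w) by (apply Rmult_le_pos; lra).
assert (Hqw : 0 < (q + 1) / w) by (apply Rdiv_lt_0_compat; lra).
destruct (nfloor_ex (g 2)) as [n Hn]; [generalize (hg1 2); lra|].
set (C1 := (q + 1) / w * Rpower (4 * K) w).
assert (HC1 : 0 < C1) by (apply Rmult_lt_0_compat; [easy | apply Rpower_pos]).
assert (HC2 : 0 < (q + 1) * PI) by (apply Rmult_lt_0_compat; lra).
apply (covered_turns_exponent p q r s alpha c w f hp hpq hr hrs halpha hc hw hpw hf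
  (C1 + (q + 1) * PI) _ (n + 1)); [lra | easy|].
intros M HM HM1.
assert (HMR : INR n + 1 <= INR M) by (rewrite <- S_INR; apply le_INR; lia).
assert (Hn0 := pos_INR n).
set (T := K * Rpower (INR M) (s / q / alpha)).
assert (HT : 2 <= T).
{ assert (H1 : 1 <= Rpower (INR M) (s / q / alpha)) by (apply Rpower_ge_1; lra); unfold T; nra. }
assert (Hpow : 1 <= Rpower (INR M) (s / q / alpha * w)) by (apply Rpower_ge_1; lra).
(* Finds a crossing between [T] and [4 * T]; this is the origin of [4 * K] in [C1]. *)
destruct (nfloor_ex (T / PI)) as [j Hj]; [apply Rlt_le, Rdiv_lt_0_compat; lra|].
assert (Hj0 : T <= half_turn (j + 1) <= 4 * T).
{ assert (ET : T = T / PI * PI) by (field; lra).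
  assert (HPI4 := PI_4).
  unfold half_turn; rewrite plus_INR; simpl (INR 1); nra. }
set (j0 := (j + 1)%nat) in *.
destruct (Rle_lt_dec (2 * PI * INR (M + M)) (g (half_turn j0))) as [L|L].
{ exists M, 2, (half_turn j0); split; [lia|]; split; [lra|]; split.
  - apply covers_of_endpoints; [lra | nra | easy].
  - apply Rle_trans with (C1 * Rpower (INR M) (s / q / alpha * w)).
    + apply arc_bound_scale; rewrite ?Rmult_assoc; fold T; lra.
    + apply Rmult_le_compat_r; lra. }
(* In the remaining case [g (half_turn j0) < 4 * PI * M], so turns starting at [6 * M] leave room
   for the extra [PI] below [A]. *)
set (A := 2 * PI * INR (6 * M)); set (B := 2 * PI * INR (6 * M + M)).
assert (EA : A = 12 * PI * INR M) by (unfold A; rewrite mult_INR; simpl; ring).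
assert (EB : B = 14 * PI * INR M) by (unfold B; rewrite plus_INR, mult_INR; simpl; ring).
(* A half turn that passes from below [A] to above [B] covers the turns [6 * M] to [7 * M] by
   itself, with bounded length. Otherwise [g] remains below [A] at all later crossings, against
   [parameter_large]. *)
destruct (classic (exists j t, (j0 <= j)%nat /\ half_turn j <= t <= half_turn (S j) /\
  g (half_turn j) <= A /\ B < g t)) as [[i [t [Hi [Ht [HgA HgB]]]]]|Hnone].
{ assert (Hi2 : 3 / 2 < half_turn i) by apply half_turn_ge.
  exists (6 * M)%nat, (half_turn i), (half_turn (S i)); split; [lia|]; split; [lra|]; split.
  - intros u Hu.
    destruct (covers_of_endpoints (6 * M) M (half_turn i) t) with (u := u) as [t' Ht'];
      [lra | easy | now apply Rlt_le | easy|].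
    exists t'; split; [easy|]; split; [lra | easy].
  - apply Rle_trans with ((q + 1) * (half_turn (S i) - half_turn i)).
    + apply arc_bound_step; lra.
    + rewrite half_turn_S; nra. }
exfalso.
assert (Hbound : forall k, g (half_turn (j0 + k)) <= A).
{ intros k; apply (half_turn_quadrant j0 A B T).
  - lra.
  - assert (Hsc := Rpower_neg_scale K (q * alpha) (INR M) s (c * Rpower 2 alpha)
      (Rpower (14 * PI) (- s)) T Hqa ltac:(lra) ltac:(lra) HC HK).
    rewrite Rpower_mult_distr in Hsc by lra; rewrite EB; apply Hsc.
    replace (s / (q * alpha)) with (s / q / alpha) by (field; lra); apply Rle_refl.
  - rewrite EA; rewrite plus_INR in L; nra.
  - rewrite EA, EB; nra.
  - intros i t Hi Ht HgA; apply Rnot_lt_le; intros HgB.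
    apply Hnone; now exists i, t. }
destruct (parameter_large A) as [t0 [Ht0 Hlarge]]; [rewrite EA; nra|].
destruct (nfloor_ex t0) as [k Hk]; [lra|].
assert (Hk1 : t0 <= half_turn (j0 + (k + 1))).
{ unfold half_turn; rewrite 2!plus_INR; simpl (INR 1); generalize (pos_INR j0); nra. }
generalize (Hlarge _ Hk1) (Hbound (k + 1)%nat); lra.
Qed.

End SpiralMap.

(** * From exponents to the final bound *)

(** For [p < 1] the value [w = 1 - p] is admissible; for [p = 1] small positive [w] give the
    limit. *)
Lemma exponent_limit (p k a b : R) :
  0 < p <= 1 -> 0 < k -> (forall w, 0 < w -> w <= 1 -> 1 - p <= w -> a <= k * w + b) ->
  a <= k * (1 - p) + b.
Proof.
intros Hp Hk H.
destruct (Req_dec p 1) as [E|E]; [|apply H; lra].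
apply Rnot_lt_le; intros L; rewrite E in L.
set (w := Rmin 1 ((a - b) / (2 * k))).
assert (Hw : 0 < w) by (apply Rmin_pos; [lra | apply Rdiv_lt_0_compat; lra]).
assert (Hw1 : w <= 1) by apply Rmin_l.
assert (Hkw : k * w <= (a - b) / 2).
{ replace ((a - b) / 2) with (k * ((a - b) / (2 * k))) by (field; lra).
  apply Rmult_le_compat_l; [lra | apply Rmin_r]. }
specialize (H w Hw Hw1); lra.
Qed.

Theorem theorem2p11 (p q r s alpha : R) (f : C -> C)
  (hp : 0 < p) (hpq : p <= q) (hr : 0 < r) (hrs : r <= s)
  (hp1 : p <= 1) (hr1 : r <= 1)
  (halpha0 : 0 < alpha) (halpha1 : alpha <= 1)
  (hmaps : maps_to f (elliptical_spiral p q) (elliptical_spiral r s))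
  (hsurj : surjective_onto f (elliptical_spiral p q) (elliptical_spiral r s))
  (hHolder : Holder_on alpha f (elliptical_spiral p q)) :
  alpha <= (p + q + r + s - p * r + q * s) / ((2 + s - r) * (p + q)).
Proof.
destruct (Holder_modulus alpha f _ halpha0 hHolder) as [c [hc hf]].
(* The default value 2 for [t <= 1] keeps [1 < g t] true everywhere. *)
assert (Hg : forall t, exists u, 1 < u /\ (1 < t -> f (spiral p q t) = spiral r s u)).
{ intros t; destruct (Rlt_dec 1 t) as [Ht|Ht]; [|exists 2; split; [lra | easy]].
  destruct (hmaps _ (spiral_in p q t Ht)) as [u [Hu E]]; now exists u. }
set (g := fun t => proj1_sig (constructive_indefinite_description _ (Hg t))).
assert (hg : forall t, 1 < g t /\ (1 < t -> f (spiral p q t) = spiral r s (g t)))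
  by (intros t; exact (proj2_sig (constructive_indefinite_description _ (Hg t)))).
clearbody g; clear Hg.
assert (hg1 := fun t => proj1 (hg t)); assert (hg2 := fun t => proj2 (hg t)).
assert (hsurj' : forall u, 1 < u -> exists t, 1 < t /\ f (spiral p q t) = spiral r s u).
{ intros u Hu; destruct (hsurj _ (spiral_in r s u Hu)) as [x [[t [Ht Ex]] E]].
  exists t; split; [easy|]; now rewrite <- E, Ex. }
assert (Hmain : forall k, k = r / p \/ k = s / q -> alpha * (2 + s - r) <= k * (1 - p) + (1 + s)).
{ intros k Hk.
  assert (Hk0 : 0 < k) by (destruct Hk as [-> | ->]; apply Rdiv_lt_0_compat; lra).
  assert (Hka : 0 < k / alpha) by now apply Rdiv_lt_0_compat.
  assert (H : 2 + s - r <= k / alpha * (1 - p) + (1 + s) / alpha).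
  { apply exponent_limit; [lra | easy|]; intros w Hw Hw1 Hpw.
    destruct (tail_bounded_or_decay p q r s alpha c f g) as [[T [B [HT HB]]]|Hdecay]; try easy.
    - apply (tail_bounded_exponent p q r s alpha c w f g) with (T := T) (B := B); try easy.
      apply Rmult_le_pos; lra.
    - destruct Hk as [-> | ->].
      + now apply (long_axis_exponent p q r s alpha c w f g).
      + now apply (short_axis_exponent p q r s alpha c w f g). }
  apply (Rmult_le_compat_l alpha) in H; [|lra].
  replace (alpha * (k / alpha * (1 - p) + (1 + s) / alpha)) with (k * (1 - p) + (1 + s)) in H
    by (field; lra); exact H. }
assert (Hden : 0 < (2 + s - r) * (p + q)) by (apply Rmult_lt_0_compat; lra).
assert (Hmediant : exists k, (k = r / p \/ k = s / q) /\ k * (p + q) <= r + s).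
{ destruct (Rle_lt_dec (r * q) (s * p)) as [L|L].
  - exists (r / p); split; [now left|].
    replace (r / p * (p + q)) with (r + r * q / p) by (field; lra).
    apply Rplus_le_compat_l, Rmult_le_reg_r with p; [easy|].
    replace (r * q / p * p) with (r * q) by (field; lra); easy.
  - exists (s / q); split; [now right|].
    replace (s / q * (p + q)) with (s * p / q + s) by (field; lra).
    apply Rplus_le_compat_r, Rmult_le_reg_r with q; [lra|].
    replace (s * p / q * q) with (s * p) by (field; lra); lra. }
destruct Hmediant as [k [Hk Hle]].
apply Rmult_le_reg_r with (1 := Hden).
unfold Rdiv; rewrite Rmult_assoc, Rinv_l, Rmult_1_r by lra.
(* The numerator is [(r + s) * (1 - p) + (1 + s) * (p + q)], the terms [p * s] cancelling. *)
assert (H1 := Rmult_le_compat_r (p + q) _ _ ltac:(lra) (Hmain k Hk)).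
assert (H2 := Rmult_le_compat_r (1 - p) _ _ ltac:(lra) Hle).
nra.
Qed.
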